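(* Every separable compact quantum group $A=C(\mathcal{G})$ with bounded counit has a bi-invariant (i.e. both left-invariant and right-invariant) regular Lip-norm.
   Context: $\otimes$ is the spatial tensor product. A compact quantum group is a pair $(A,\Phi)$, $A$ a unital $C^*$-algebra and $\Phi:A\to A\otimes A$ a unital $*$-homomorphism, with $(\mathrm{id}\otimes\Phi)\Phi=(\Phi\otimes\mathrm{id})\Phi$ and with the linear spans $\Phi(A)(1_A\otimes A)$ and $\Phi(A)(A\otimes1_A)$ dense in $A\otimes A$; one writes $A=C(\mathcal{G})$. It is separable if $A$ is separable. $\mathcal{A}\subseteq A$ is the dense $*$-subalgebra of regular functions, spanned by the matrix coefficients of irreducible unitary representations. The counit is the unique $*$-homomorphism $e:\mathcal{A}\to\mathbb{C}$ with $(e\otimes\mathrm{id})\Phi=(\mathrm{id}\otimes e)\Phi=\mathrm{id}$ on $\mathcal{A}$; bounded means bounded for the norm of $A$. A Lip-norm on a unital $C^*$-algebra $B$ is a (possibly $+\infty$-valued) seminorm $L$ on $B$ with $L(b)=L(b^* )$ for all $b$, vanishing on $\mathbb{C}1_B$, such that the metric $\rho_L(\varphi,\psi)=\sup_{L(b)\le1}|\varphi(b)-\psi(b)|$ on the state space $S(B)$ induces the weak-$*$ topology. A Lip-norm $L_A$ on $A$ is regular if it is finite on $\mathcal{A}$. For $a\in A$, $\psi\in S(A)$ put $\psi*a=(\mathrm{id}\otimes\psi)\Phi(a)$ and $a*\psi=(\psi\otimes\mathrm{id})\Phi(a)$. $L_A$ is right-invariant (left-invariant) if $L_A(\psi*a)\le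 L_A(a)$ ($L_A(a*\psi)\le L_A(a)$) for all self-adjoint $a\in A$ and all $\psi\in S(A)$. *)

(* Defs.v *)
From HB Require Import structures.
From mathcomp Require Import all_boot all_order all_algebra.
From mathcomp Require Import all_classical all_reals all_analysis.
From mathcomp Require Export complex.

Set Implicit Arguments.
Unset Strict Implicit.
Unset Printing Implicit Defensive.

Import Order.TTheory GRing.Theory Num.Theory.
Import numFieldNormedType.Exports.
Import ComplexField.Normc.

Local Open Scope classical_set_scope.
Local Open Scope ring_scope.
Local Open Scope complex_scope.

(* Unital C*-algebras, with 1 <> 0. Hierarchy-Builder admits no join of the algebra and the
   normed module structures (number domains already inherit from both), so the
   product and the unit are part of the mixin, and the algType structure is
   derived from it below. The norm of a normed module over R[i] takes values in
   R[i] (they are real and nonnegative). *)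
HB.mixin Record isCStarAlgebra (R : realType) A
    of CompleteNormedModule R[i] A := {
  cmul : A -> A -> A ;
  cone : A ;
  star : A -> A ;
  cmulA : associative cmul ;
  cmul1l : left_id cone cmul ;
  cmul1r : right_id cone cmul ;
  cmulDl : left_distributive cmul +%R ;
  cmulDr : right_distributive cmul +%R ;
  cone_neq0 : cone != 0 ;
  cscaleAl : forall (c : R[i]) (x y : A), c *: cmul x y = cmul (c *: x) y ;
  cscaleAr : forall (c : R[i]) (x y : A), c *: cmul x y = cmul x (c *: y) ;
  starK : involutive star ;
  starD : forall x y : A, star (x + y) = star x + star y ;
  starZ : forall (c : R[i]) (x : A), star (c *: x) = Num.conj c *: star x ;
  starM : forall x y : A, star (cmul x y) = cmul (star y) (star x) ;
  cstar_normM : forall x y : A, `|cmul x y| <= `|x| * `|y| ;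
  cstar_normE : forall x : A, `|cmul (star x) x| = `|x| ^+ 2
}.

#[short(type="cstarAlgType")]
HB.structure Definition CStarAlgebra (R : realType) :=
  {A of CompleteNormedModule R[i] A & isCStarAlgebra R A}.

#[non_forgetful_inheritance]
HB.instance Definition _ (R : realType) (A : cstarAlgType R) :=
  GRing.Zmodule_isNzRing.Build A (@cmulA R A) (@cmul1l R A) (@cmul1r R A)
    (@cmulDl R A) (@cmulDr R A) (@cone_neq0 R A).

#[non_forgetful_inheritance]
HB.instance Definition _ (R : realType) (A : cstarAlgType R) :=
  GRing.Lmodule_isLalgebra.Build R[i] A (@cscaleAl R A).

#[non_forgetful_inheritance]
HB.instance Definition _ (R : realType) (A : cstarAlgType R) :=
  GRing.Lalgebra_isAlgebra.Build R[i] A (@cscaleAr R A).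

Definition lspan (R : realType) (V : lmodType R[i]) (S : set V) : set V :=
  [set v | exists (n : nat) (c : 'I_n -> R[i]) (x : 'I_n -> V),
     (forall i, S (x i)) /\ v = \sum_(i < n) c i *: x i].

Record unital_star_hom (R : realType) (A B : cstarAlgType R) (f : A -> B)
    : Prop := UnitalStarHom {
  ushom_linear : linear f ;
  ushomM : forall x y : A, f (x * y) = f x * f y ;
  ushom1 : f 1 = 1 ;
  ushom_star : forall x : A, f (star x) = star (f x)
}.

(* The inner product is linear in the first variable. *)
Record hilbertType (R : realType) := HilbertType {
  hilbert_sort :> completeNormedModType R[i] ;
  inner : {dot hilbert_sort for Num.conj} ;
  inner_norm : forall x : hilbert_sort, inner x x = `|x| ^+ 2
}.

Record representation (R : realType) (A : cstarAlgType R) (H : hilbertType R)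
    (pi : A -> H -> H) : Prop := Representation {
  repr_linear : forall a, linear (pi a) ;
  repr_continuous : forall a, continuous (pi a) ;
  repr_linearl : forall v, linear (fun a => pi a v) ;
  reprM : forall a b v, pi (a * b) v = pi a (pi b v) ;
  repr1 : forall v, pi 1 v = v ;
  repr_star : forall a v w, inner H (pi a v) w = inner H v (pi (star a) w)
}.

Section SpatialNorm.
Variables (R : realType) (A B : cstarAlgType R) (H K : hilbertType R).

(* A list t stands for the vector \sum_(p <- t) p.1 (x) p.2 of the algebraic
   tensor product of H and K; tensor_norm t is its norm in the Hilbert space
   tensor product, where <v (x) w, v' (x) w'> = <v, v'> <w, w'>. *)
Definition tensor_norm (t : seq (H * K)) : R :=
  Num.sqrt (complex.Re
    (\sum_(p <- t) \sum_(q <- t) inner H p.1 q.1 * inner K p.2 q.2)).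

(* The list x stands for \sum_(p <- x) p.1 (x) p.2 in the algebraic tensor
   product of A and B, which acts through pi (x) rho. *)
Definition tensor_act (pi : A -> H -> H) (rho : B -> K -> K)
    (x : seq (A * B)) (t : seq (H * K)) : seq (H * K) :=
  [seq (pi p.1 q.1, rho p.2 q.2) | p <- x, q <- t].

(* The operator norm of (pi (x) rho)(x); vectors of the algebraic tensor
   product suffice, since they are dense in the Hilbert space one. *)
Definition spatial_norm (pi : A -> H -> H) (rho : B -> K -> K)
    (x : seq (A * B)) : R :=
  sup [set tensor_norm (tensor_act pi rho x t)
         | t in [set t | tensor_norm t <= 1]].

End SpatialNorm.

(* T, with tens a b in the role of a (x) b, is the spatial tensor product of A
   and B: the completion of their algebraic tensor product for the norm coming
   from faithful representations on H and K, that is, its closure in B(H (x) K).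
   This norm does not depend on the two representations, so that T is unique up
   to a unique isomorphism commuting with tens. *)
Record spatial_tensor (R : realType) (A B T : cstarAlgType R)
    (tens : A -> B -> T) : Prop := SpatialTensor {
  tens_linearl : forall b, linear (tens^~ b) ;
  tens_linearr : forall a, linear (tens a) ;
  tensM : forall a a' b b', tens a b * tens a' b' = tens (a * a') (b * b') ;
  tens1 : tens 1 1 = 1 ;
  tens_star : forall a b, star (tens a b) = tens (star a) (star b) ;
  tens_dense : dense (lspan [set x | exists a b, x = tens a b]) ;
  tens_norm : exists (H K : hilbertType R)
      (pi : A -> H -> H) (rho : B -> K -> K),
    [/\ representation pi, injective pi, representation rho, injective rho &
      forall x : seq (A * B),
        `| \sum_(p <- x) tens p.1 p.2 | = (spatial_norm pi rho x)%:C ]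
}.

(* cqg2 and cqg3 are A (x) A and A (x) A (x) A; the latter is regarded both as
   (A (x) A) (x) A and as A (x) (A (x) A). *)
Record compactQuantumGroup (R : realType) := CompactQuantumGroup {
  cqg :> cstarAlgType R ;
  cqg2 : cstarAlgType R ;
  cqg3 : cstarAlgType R ;
  tens : cqg -> cqg -> cqg2 ;
  tens21 : cqg2 -> cqg -> cqg3 ;
  tens12 : cqg -> cqg2 -> cqg3 ;
  comult : cqg -> cqg2 ;
  tens_spatial : spatial_tensor tens ;
  tens21_spatial : spatial_tensor tens21 ;
  tens12_spatial : spatial_tensor tens12 ;
  tens_assoc : forall a b c, tens21 (tens a b) c = tens12 a (tens b c) ;
  comult_hom : unital_star_hom comult ;
  (* f and g are Phi (x) id and id (x) Phi. *)
  comult_coassoc : exists f g : cqg2 -> cqg3,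
    [/\ unital_star_hom f /\ forall a b, f (tens a b) = tens21 (comult a) b,
        unital_star_hom g /\ forall a b, g (tens a b) = tens12 a (comult b) &
        forall a, g (comult a) = f (comult a) ] ;
  comult_densel :
    dense (lspan [set x | exists a b, x = comult a * tens 1 b]) ;
  comult_denser :
    dense (lspan [set x | exists a b, x = comult a * tens b 1])
}.

Definition separable (T : topologicalType) : Prop :=
  exists S : set T, countable S /\ dense S.

Section CompactQuantumGroup.
Variables (R : realType) (G : compactQuantumGroup R).

Definition mxstar n (u : 'M[G]_n) : 'M[G]_n := (map_mx star u)^T.

(* A unitary representation on the Hilbert space C^n, as a unitary of M_n(A). *)
Definition unitary_rep n (u : 'M[G]_n) : Prop :=
  [/\ u *m mxstar u = 1%:M, mxstar u *m u = 1%:M &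
      forall i j, comult (u i j) = \sum_(k < n) tens (u i k) (u k j)].

(* No invariant subspace other than 0 and C^n; p is the orthogonal projection
   onto the subspace, and q = p (x) 1. *)
Definition irreducible_rep n (u : 'M[G]_n) : Prop :=
  (0 < n)%N /\
  forall p : 'M[R[i]]_n, p *m p = p -> (map_mx Num.conj p)^T = p ->
    let q : 'M[G]_n := map_mx (in_alg G) p in
    q *m u *m q = u *m q -> p = 0 \/ p = 1%:M.

(* Irreducible unitary representations of a compact quantum group are
   finite-dimensional. *)
Definition regular_functions : set G :=
  lspan [set x | exists (n : nat) (u : 'M[G]_n),
    [/\ unitary_rep u, irreducible_rep u & exists i j, x = u i j]].

(* Only the values of e on regular functions matter. As Phi maps regular
   functions into the algebraic tensor square of regular_functions, and as
   decompositions in it are unique, the last clause says that (e (x) id) Phi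
   and (id (x) e) Phi are the identity on regular functions. *)
Definition is_counit (e : G -> R[i]) : Prop :=
  let A0 := regular_functions in
  [/\ forall (c : R[i]) (a b : G), A0 a -> A0 b ->
        e (c *: a + b) = c * e a + e b,
      forall a b : G, A0 a -> A0 b -> e (a * b) = e a * e b,
      forall a : G, A0 a -> e (star a) = Num.conj (e a) &
      forall (a : G) (n : nat) (x y : 'I_n -> G), A0 a ->
        (forall i, A0 (x i)) -> (forall i, A0 (y i)) ->
        comult a = \sum_(i < n) tens (x i) (y i) ->
        \sum_(i < n) e (x i) *: y i = a /\ \sum_(i < n) e (y i) *: x i = a].

Definition bounded_counit : Prop :=
  exists e : G -> R[i], is_counit e /\
    exists M : R, forall a : G, regular_functions a -> `|e a| <= M%:C * `|a|.

End CompactQuantumGroup.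

Definition state (R : realType) (B : cstarAlgType R) : set (B -> R[i]) :=
  [set phi | [/\ scalar phi, forall b, 0 <= phi (star b * b) & phi 1 = 1]].

Section LipNorm.
Variables (R : realType) (B : cstarAlgType R) (L : B -> \bar R).
Local Open Scope ereal_scope.

(* As 0 * +oo = 0 in \bar R, homogeneity includes L 0 = 0. *)
Definition ext_seminorm : Prop :=
  [/\ forall b, 0 <= L b,
      forall (c : R[i]) b, L (c *: b)%R = (normc c)%:E * L b &
      forall a b, L (a + b)%R <= L a + L b].

Definition state_dist (phi psi : B -> R[i]) : \bar R :=
  ereal_sup [set (normc (phi b - psi b))%:E | b in [set b | L b <= 1]].

(* The weak-* topology of the state space is the one induced by the topology of
   pointwise convergence. *)
Definition induces_weak_star : Prop :=
  forall phi : {ptws B -> R[i]^o}, state phi ->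
  forall U : set {ptws B -> R[i]^o},
    within (@state R B) (nbhs phi) U <->
    exists2 r : R, (0 < r)%R &
      forall psi, state psi -> state_dist phi psi < r%:E -> U psi.

Definition lip_norm : Prop :=
  [/\ ext_seminorm, forall b, L b = L (star b),
      forall c : R[i], L (c *: 1)%R = 0 & induces_weak_star].

End LipNorm.

Section Invariance.
Variables (R : realType) (G : compactQuantumGroup R).

(* The slice maps id (x) psi and psi (x) id: the only continuous linear maps
   with the given values on elementary tensors. They exist for every state psi,
   so the default value of xget plays no role. *)
Definition slicer (psi : G -> R[i]) : cqg2 G -> G :=
  xget (fun=> 0) [set s : cqg2 G -> G |
    [/\ linear s, continuous s & forall a b, s (tens a b) = psi b *: a]].

Definition slicel (psi : G -> R[i]) : cqg2 G -> G :=
  xget (fun=> 0) [set s : cqg2 G -> G |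
    [/\ linear s, continuous s & forall a b, s (tens a b) = psi a *: b]].

(* psi * a *)
Definition convl (psi : G -> R[i]) (a : G) : G := slicer psi (comult a).

(* a * psi *)
Definition convr (a : G) (psi : G -> R[i]) : G := slicel psi (comult a).

Variable L : G -> \bar R.
Local Open Scope ereal_scope.

Definition regular : Prop := forall a, regular_functions a -> L a < +oo.

Definition right_invariant : Prop :=
  forall a : G, star a = a -> forall psi, state psi -> L (convl psi a) <= L a.

Definition left_invariant : Prop :=
  forall a : G, star a = a -> forall psi, state psi -> L (convr a psi) <= L a.

End Invariance.

(* Main.v *)
(** Write psi * a * phi for the translates of a by states. Since Phi(a) is a norm
    limit of finite sums of x (x) y, the set of all translates of a single a is
    totally bounded as far as states can see, and it is stable under further
    translation because convolution of states is associative. Hence for every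
    sequence (a_n) dense in A, the gauge of the absolutely convex hull of the
    orbits of the a_n, shrunk by weights tending to 0, and of the scalars, is a
    bi-invariant Lip-norm that is finite at every a_n.

    For regularity, the a_n must also include countably many matrix coefficients
    whose span contains all regular functions. It suffices that two unitary
    representations u, v in M_n(A), with u irreducible and v close to u, are
    equivalent. Let psi be a state that is faithful on a suitable
    finite-dimensional subspace, obtained as a finite sum of vector states. The
    Cesaro means of the power-bounded map T |-> (id (x) psi)(v^* T u), started at
    1, converge to a fixed point T close to 1, hence invertible. Put X = v^* T u
    and S = T^* T. Then

      (id (x) psi)((X - T)^*(X - T)) = (id (x) psi)(u^* S u) - S,

    so S is subharmonic for the positive unital map on the right. Faithfulness
    makes its top eigenspace invariant under u, so S is scalar, both sides vanish,
    and X = T, that is T u = v T.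

    States on A and B extend to a product state on A (x) B because a self-adjoint
    element that is positive in a faithful representation is a square, which is
    proved with an iteration for the square root instead of spectral theory. *)

From HB Require Import structures.
Require Import Defs.
From mathcomp Require Import all_boot all_order all_algebra.
From mathcomp Require Import all_classical all_reals all_analysis.
From mathcomp Require Import ring lra.

Set Implicit Arguments.
Unset Strict Implicit.
Unset Printing Implicit Defensive.

Import Order.TTheory GRing.Theory Num.Theory.
Import numFieldNormedType.Exports.
Import ComplexField.Normc.

Local Open Scope classical_set_scope.
Local Open Scope ring_scope.
Local Open Scope complex_scope.

(** * Real-valued norms *)

Section LinearMap.
Variables (K : pzRingType) (U V : lmodType K) (f : U -> V).
Hypothesis fl : linear f.

Lemma linear_mapD x y : f (x + y) = f x + f y.
Proof. by have := fl 1 x y; rewrite !scale1r. Qed.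

Lemma linear_map0 : f 0 = 0.
Proof. by apply: (addrI (f 0)); rewrite -linear_mapD !addr0. Qed.

Lemma linear_mapZ c x : f (c *: x) = c *: f x.
Proof. by rewrite -(addr0 (c *: x)) fl linear_map0 addr0. Qed.

End LinearMap.

Section Modulus.
Variable R : realType.
Implicit Types z w : R[i].

Lemma normc_real (r : R) : normc r%:C = `|r|.
Proof. by rewrite /= expr0n /= addr0 sqrtr_sqr. Qed.

Lemma normc_mul z w : normc (z * w) = (normc z : R) * normc w.
Proof. exact: normcM. Qed.

Lemma normc_ge0 z : 0 <= normc z.
Proof. by case: z => a b; exact: sqrtr_ge0. Qed.

Lemma normc_add z w : normc (z + w) <= (normc z : R) + normc w.
Proof. exact: le_normcD. Qed.

Lemma normc_opp z : normc (- z) = normc z :> R.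
Proof. exact: normcN. Qed.

Lemma normc_subC z w : normc (z - w) = normc (w - z) :> R.
Proof. by rewrite -normc_opp opprB. Qed.

Lemma normc_tri w z v : normc (z - v) <= (normc (z - w) : R) + normc (w - v).
Proof. by rewrite -(addrNK w z) -addrA (le_trans (normc_add _ _)) // addrK. Qed.

Lemma conjc_sum I (r : seq I) (P : pred I) (F : I -> R[i]) :
  Num.conj (\sum_(i <- r | P i) F i) = \sum_(i <- r | P i) Num.conj (F i).
Proof. exact: rmorph_sum. Qed.

Lemma normc_sum I (r : seq I) (P : pred I) (F : I -> R[i]) :
  normc (\sum_(i <- r | P i) F i) <= \sum_(i <- r | P i) (normc (F i) : R).
Proof.
elim/big_rec2: _ => [|i a b _ h]; first by rewrite normc0.
by rewrite (le_trans (normc_add _ _)) // lerD2l.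
Qed.

Lemma normc_phase z : exists2 c : R[i], normc c = 1 & c * z = (normc z)%:C.
Proof.
have [->|z0] := eqVneq z 0; first by exists 1; rewrite ?normc1 // mulr0 normc0.
have n0 : normc z != 0 by apply: contra z0 => /eqP/eq0_normc ->.
exists ((normc z)%:C / z); last by rewrite mulrVK ?unitfE.
by rewrite normc_mul normcV normc_real ger0_norm ?normc_ge0 // mulfV.
Qed.

Lemma Re_le_normc z : `|complex.Re z| <= normc z.
Proof. by case: z => a b /=; rewrite -sqrtr_sqr ler_wsqrtr // lerDl sqr_ge0. Qed.

Lemma Im_le_normc z : `|complex.Im z| <= normc z.
Proof. by case: z => a b /=; rewrite -sqrtr_sqr ler_wsqrtr // lerDr sqr_ge0. Qed.

Lemma normc_le_ReIm z : normc z <= `|complex.Re z| + `|complex.Im z|.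
Proof.
case: z => a b /=; rewrite -[leRHS]ger0_norm ?addr_ge0 // -[leRHS]sqrtr_sqr ler_wsqrtr //.
rewrite -(real_normK (num_real a)) -(real_normK (num_real b)) sqrrD.
by have := normr_ge0 a; have := normr_ge0 b; nra.
Qed.

(** The constant [C] is arbitrary, so a limiting argument may end with any fixed multiple of the
    error. *)
Lemma le0_eps (x C : R) : (forall e, 0 < e -> x <= C * e) -> x <= 0.
Proof.
move=> h; apply/ler_addgt0Pr => e e0; rewrite add0r.
have C0 : 0 < `|C| + 1 by rewrite ltr_wpDl.
apply: le_trans (h (e / (`|C| + 1)) (divr_gt0 e0 C0)) _.
rewrite mulrA ler_pdivrMr // mulrC ler_wpM2l ?(ltW e0) //.
by rewrite (le_trans (ler_norm _)) // lerDl.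
Qed.

Lemma normc_eps z (C : R) : (forall e : R, 0 < e -> normc z <= C * e) -> z = 0.
Proof.
by move=> /le0_eps h; apply: eq0_normc; apply/eqP; rewrite eq_le h normc_ge0.
Qed.

(** In the order of [R[i]], nonnegativity includes a vanishing imaginary part, so the two parts are
    estimated separately. *)
Lemma ge0_eps z (C : R) : (forall e : R, 0 < e -> exists2 p, 0 <= p & normc (z - p) <= C * e) ->
  0 <= z.
Proof.
move=> h; rewrite lecE.
have -> : complex.Im z = 0.
  apply/eqP; rewrite -normr_eq0 eq_le normr_ge0 andbT; apply: (@le0_eps _ C) => e e0.
  have [p p0 hp] := h _ e0; apply: le_trans _ hp; apply: le_trans _ (Im_le_normc _).
  by rewrite raddfB /= (ger0_Im p0) subr0.
rewrite eqxx /= -oppr_le0; apply: (@le0_eps _ C) => e e0.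
have [p p0 hp] := h _ e0; apply: le_trans _ hp; apply: le_trans _ (Re_le_normc _).
rewrite raddfB /= distrC (le_trans _ (ler_norm _)) // lerDr.
by move: p0; rewrite lecE => /andP[].
Qed.

End Modulus.

Section Norm.
Variables (R : realType) (V : normedModType R[i]).
Implicit Types x y : V.

(** The norm of a normed module over [R[i]] has values in [R[i]]; its real form makes real
    arithmetic and order reasoning available. *)
Definition nrm x : R := complex.Re `|x|.

Lemma nrmE x : `|x| = (nrm x)%:C.
Proof. by apply/esym/RRe_real/normr_real. Qed.

Lemma nrm_ge0 x : 0 <= nrm x.
Proof. by rewrite -ler0c -nrmE normr_ge0. Qed.

Lemma nrm0 : nrm 0 = 0.
Proof. by rewrite /nrm normr0. Qed.

Lemma nrm_eq0 x : nrm x = 0 -> x = 0.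
Proof. by move=> h; apply/eqP; rewrite -normr_eq0 nrmE h. Qed.

Lemma nrmN x : nrm (- x) = nrm x.
Proof. by rewrite /nrm normrN. Qed.

Lemma nrmD x y : nrm (x + y) <= nrm x + nrm y.
Proof. by rewrite -lecR rmorphD /= -!nrmE ler_normD. Qed.

Lemma nrmBC x y : nrm (x - y) = nrm (y - x).
Proof. by rewrite -nrmN opprB. Qed.

Lemma nrmB x y : nrm (x - y) <= nrm x + nrm y.
Proof. by rewrite -(nrmN y) nrmD. Qed.

Lemma nrm_tri y x z : nrm (x - z) <= nrm (x - y) + nrm (y - z).
Proof. by rewrite -(addrNK y x) -addrA (le_trans (nrmD _ _)) // addrK. Qed.

Lemma nrmZ (c : R[i]) x : nrm (c *: x) = normc c * nrm x.
Proof. by rewrite /nrm normrZ nrmE /= mul0r subr0. Qed.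

Lemma nrmZr (r : R) x : 0 <= r -> nrm (r%:C *: x) = r * nrm x.
Proof. by move=> r0; rewrite nrmZ normc_real ger0_norm. Qed.

Lemma nrm_sum I (r : seq I) (P : pred I) (F : I -> V) :
  nrm (\sum_(i <- r | P i) F i) <= \sum_(i <- r | P i) nrm (F i).
Proof.
elim/big_rec2: _ => [|i a b _ h]; first by rewrite nrm0.
by rewrite (le_trans (nrmD _ _)) // lerD2l.
Qed.

Lemma nrm_eps x (C : R) : (forall e, 0 < e -> nrm x <= C * e) -> x = 0.
Proof. by move=> /le0_eps h; apply/nrm_eq0/le_anti; rewrite h nrm_ge0. Qed.

Lemma dense_nrm (S : set V) : dense S ->
  forall x (e : R), 0 < e -> exists2 y, S y & nrm (x - y) < e.
Proof.
move=> dS x e e0.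
have e0' : (0 : R[i]) < e%:C by rewrite ltcR.
have [y [xy Sy]] := dS (ball x e%:C) (ex_intro _ x (ballxx x e0')) (ball_open x _).
by exists y => //; move: xy; rewrite -ball_normE /= nrmE ltcR.
Qed.

End Norm.

Lemma continuous_nrm (R : realType) (V W : normedModType R[i]) (f : V -> W) : continuous f ->
  forall x (e : R), 0 < e -> exists2 d : R, 0 < d &
  forall y, nrm (x - y) < d -> nrm (f x - f y) < e.
Proof.
move=> cf x e e0.
have e0' : (0 : R[i]) < e%:C by rewrite ltcR.
have /nbhs_ballP[d /= d0 hd] := cf x _ (nbhsx_ballx (f x) _ e0').
have dE : d = (complex.Re d)%:C by apply/esym/RRe_real/gtr0_real.
exists (complex.Re d); first by rewrite -ltcR -dE.
move=> y hy; have : ball x d y by rewrite -ball_normE /= nrmE dE ltcR.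
by move/hd; rewrite -ball_normE /= nrmE ltcR.
Qed.

Lemma nrm_complete (R : realType) (V : completeNormedModType R[i]) (u : nat -> V) :
  (forall e : R, 0 < e -> exists N, forall m n, (N <= m)%N -> (N <= n)%N ->
     nrm (u m - u n) < e) ->
  exists l, forall e : R, 0 < e -> exists N, forall n, (N <= n)%N ->
     nrm (u n - l) < e.
Proof.
move=> hu.
have : cvg (u @ \oo).
  apply: cauchy_cvg; apply/cauchyP => e e0.
  have eE : e = (complex.Re e)%:C by apply/esym/RRe_real/gtr0_real.
  have e0' : 0 < complex.Re e by rewrite -ltcR -eE.
  have [N hN] := hu _ e0'; exists (u N); exists N => // n /= Nn.
  by rewrite -ball_normE /= nrmE eE ltcR; apply: hN.
move=> /cvg_ex [l hl]; exists l => e e0.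
have e0' : (0 : R[i]) < e%:C by rewrite ltcR.
have [N _ hN] := hl _ (nbhsx_ballx l _ e0').
exists N => n Nn; have := hN n Nn.
by rewrite -ball_normE /= nrmE ltcR nrmBC.
Qed.

Section CStar.
Variables (R : realType) (A : cstarAlgType R).
Implicit Types x y : A.

Lemma nrmM x y : nrm (x * y) <= nrm x * nrm y.
Proof. by have := cstar_normM x y; rewrite !nrmE -rmorphM lecR. Qed.

Lemma nrm_starM x : nrm (star x * x) = nrm x ^+ 2.
Proof.
by have := cstar_normE x; rewrite !nrmE -rmorphXn => /complexI.
Qed.

Lemma nrm_star x : nrm (star x) = nrm x.
Proof.
have le (z : A) : nrm z <= nrm (star z).
  have [/nrm_eq0 ->|/eqP n0] := eqVneq (nrm z) 0; first by rewrite nrm0 nrm_ge0.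
  have z0 : 0 < nrm z by rewrite lt_neqAle eq_sym (introN eqP) // nrm_ge0.
  by have := nrmM (star z) z; rewrite nrm_starM expr2 ler_pM2r.
by apply/eqP; rewrite eq_le -{2}(starK x) !le.
Qed.

Lemma star0 : star (0 : A) = 0.
Proof. by rewrite -{1}(scale0r (0 : A)) starZ rmorph0 scale0r. Qed.

Lemma starN x : star (- x) = - star x.
Proof. by apply: (addrI (star x)); rewrite -starD !subrr star0. Qed.

Lemma starB x y : star (x - y) = star x - star y.
Proof. by rewrite starD starN. Qed.

Lemma starMr x y : star (x * y) = star y * star x.
Proof. exact: starM. Qed.

Lemma star1 : star (1 : A) = 1.
Proof. by rewrite -[LHS]mulr1 -{2}(starK (1 : A)) -starMr mulr1 starK. Qed.

Lemma star_sum I (r : seq I) (P : pred I) (F : I -> A) :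
  star (\sum_(i <- r | P i) F i) = \sum_(i <- r | P i) star (F i).
Proof. by apply: (big_morph _ starD star0). Qed.

Lemma nrm1 : nrm (1 : A) = 1.
Proof.
have := nrm_starM (1 : A); rewrite star1 mulr1 expr2 => h.
apply: (mulfI _ (x := nrm (1 : A))); last by rewrite mulr1.
by apply/eqP => /nrm_eq0 /eqP; apply/negP; exact: cone_neq0.
Qed.

End CStar.

(** * Square roots and absolute values *)

Section Roots.
Variables (R : realType) (A : cstarAlgType R).
Implicit Types x y : A.

Lemma conj_real (r : R) : Num.conj (r%:C : R[i]) = r%:C.
Proof. exact: conjc_real. Qed.

Lemma starZr (r : R) x : star (r%:C *: x) = r%:C *: star x.
Proof. by rewrite starZ conj_real. Qed.

Lemma halfD x : (2^-1 : R)%:C *: (x + x) = x.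
Proof.
have h : 2^-1 + 2^-1 = 1 :> R by lra.
by rewrite scalerDr -scalerDl -rmorphD /= h scale1r.
Qed.

(* z is the limit of the iterates y' = (x + y^2) / 2; since these are
   polynomials in x with nonnegative coefficients, their increments are
   dominated by those of the scalar sequence t' = (1 + t^2) / 2, which is
   bounded by 1. *)
Lemma sqrt_one_sub x : star x = x -> nrm x <= 1 ->
  exists z, [/\ star z = z, nrm z <= 1, (1 - z) * (1 - z) = 1 - x &
    forall w, w * x = x * w -> w * z = z * w].
Proof.
move=> sx x1.
pose t := fix t n : R := if n is m.+1 then (1 + t m ^+ 2) / 2 else 0.
pose y := fix y n : A := if n is m.+1 then (2^-1 : R)%:C *: (x + y m * y m) else 0.
have h0 : 0 <= 2^-1 :> R by rewrite invr_ge0.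
have tS n : t n.+1 = (1 + t n ^+ 2) / 2 by [].
have yS n : y n.+1 = (2^-1 : R)%:C *: (x + y n * y n) by [].
have t0 n : 0 <= t n <= 1.
  elim: n => [|n /andP[a b]]; first by rewrite lexx ler01.
  by rewrite tS; nra.
have tle n : t n <= t n.+1 by have := t0 n; rewrite tS; nra.
have ycomm w n : w * x = x * w -> w * y n = y n * w.
  move=> wx; elim: n => [|n ih]; first by rewrite mulr0 mul0r.
  rewrite yS -scalerAr -scalerAl mulrDr mulrDl wx mulrA ih -mulrA ih.
  by rewrite mulrA.
have ycommy m n : y m * y n = y n * y m.
  by apply/ycomm/esym/ycomm.
have ys n : star (y n) = y n.
  elim: n => [|n ih]; first by rewrite star0.
  by rewrite yS starZr starD starMr ih sx.
have yt n : nrm (y n) <= t n.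
  elim: n => [|n ih]; first by rewrite nrm0.
  rewrite yS tS nrmZr // mulrC ler_wpM2r // (le_trans (nrmD _ _)) // lerD //.
  rewrite (le_trans (nrmM _ _)) // expr2 ler_pM ?nrm_ge0 //.
have yd n : nrm (y n.+1 - y n) <= t n.+1 - t n.
  elim: n => [|n ih].
    rewrite yS /= mul0r addr0 !subr0 nrmZr // expr0n /= addr0 mul1r.
    by rewrite -[leRHS]mulr1 ler_wpM2l.
  (* The iterates commute, so the difference of their squares factors. *)
  have -> : y n.+2 - y n.+1 = (2^-1 : R)%:C *: ((y n.+1 - y n) * (y n.+1 + y n)).
    rewrite (yS n.+1) {2}(yS n) -scalerBr; congr (_ *: _).
    by rewrite mulrBl !mulrDr (ycommy n n.+1) opprD addrACA subrr add0r opprD addrA addrK.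
  rewrite nrmZr //.
  have h1 := nrmM (y n.+1 - y n) (y n.+1 + y n).
  have h2 := nrmD (y n.+1) (y n).
  have h3 := yt n; have h4 := yt n.+1; have h5 := nrm_ge0 (y n.+1 - y n).
  have h6 := nrm_ge0 (y n.+1 + y n).
  have -> : t n.+2 - t n.+1 = 2^-1 * ((t n.+1 - t n) * (t n.+1 + t n)).
    by rewrite (tS n.+1) {2}(tS n); field.
  rewrite ler_wpM2l //; apply: le_trans h1 _; apply: ler_pM => //.
  by apply: le_trans h2 _; apply: lerD.
have ydk n k : nrm (y (n + k)%N - y n) <= t (n + k)%N - t n.
  elim: k => [|k ih]; first by rewrite addn0 !subrr nrm0.
  apply: le_trans (nrm_tri (y (n + k)%N) _ _) _; rewrite addnS.
  by have := yd (n + k)%N; lra.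
have tmono n k : t n <= t (n + k)%N.
  by elim: k => [|k ih]; rewrite ?addn0 // addnS (le_trans ih).
have ht : has_sup (range t).
  by split; [exists 0, 0%N|exists 1 => _ [n _ <-]; have /andP[] := t0 n].
have [z hz] : exists z, forall e : R, 0 < e -> exists N, forall n, (N <= n)%N ->
    nrm (y n - z) < e.
  apply: nrm_complete => e e0.
  have e2 : 0 < e / 2 by lra.
  have [_ [N _ <-] hN] := sup_adherent e2 ht.
  have hNn n : (N <= n)%N -> nrm (y n - y N) < e / 2.
    move=> /subnKC <-; apply: le_lt_trans (ydk _ _) _.
    have : t (N + (n - N))%N <= sup (range t) by apply: sup_upper_bound => //; exists (N + (n - N))%N.
    lra.
  exists N => m n /hNn a /hNn b.
  by apply: le_lt_trans (nrm_tri (y N) _ _) _; rewrite (nrmBC (y N)); lra.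
have sz : star z = z.
  apply/eqP; rewrite -subr_eq0; apply/eqP; apply: (nrm_eps (C := 2)) => e e0.
  have [N /(_ N (leqnn _)) hN] := hz _ e0.
  apply: le_trans (nrm_tri (y N) _ _) _.
  have -> : nrm (star z - y N) = nrm (y N - z) by rewrite -nrm_star starB starK ys nrmBC.
  lra.
have z1 : nrm z <= 1.
  apply/ler_addgt0Pr => e e0; have [N /(_ N (leqnn _)) hN] := hz _ e0.
  have := nrm_tri (y N) z 0; rewrite !subr0 nrmBC.
  by have := yt N; have := t0 N; lra.
exists z; split=> //.
- suff h : (x + z * z) - (z + z) = 0.
    have -> : x = z + z - z * z by rewrite -(subr0_eq h) addrK.
    rewrite mulrBl mul1r mulrBr mulr1 !opprB opprD -addrA.
    by rewrite [- z + _]addrCA.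
  apply: (nrm_eps (C := 4)) => e e0; have [N hN] := hz _ e0.
  have hN1 := hN N (leqnn _); have hN2 := hN N.+1 (leqnSn _).
  (* The recursion replaces [x + y N * y N] by twice the next iterate, so that only terms with a
     factor [z - y N] or [y N.+1 - z] remain. *)
  have -> : x + z * z - (z + z) = ((z - y N) * z + y N * (z - y N)) +
      ((y N.+1 - z) + (y N.+1 - z)).
    have : y N.+1 + y N.+1 = x + y N * y N.
      by rewrite -scalerDr halfD.
    move=> h; rewrite [X in _ = _ + X]addrACA h -opprD mulrBl mulrBr [z * z - _ + _]addrA addrNK.
    by rewrite addrA [x + y N * _]addrC addrA addrNK [x + _]addrC.
  rewrite (le_trans (nrmD _ _)) //.
  have h1 := nrmD ((z - y N) * z) (y N * (z - y N)).
  have h2 := nrmD (y N.+1 - z) (y N.+1 - z).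
  have h3 := nrmM (z - y N) z; have h4 := nrmM (y N) (z - y N).
  have h5 := yt N; have /andP[_ h6] := t0 N; rewrite nrmBC in hN1.
  have h7 := nrm_ge0 (z - y N); have h8 := nrm_ge0 z; have h9 := nrm_ge0 (y N).
  nra.
- move=> w wx; apply/eqP; rewrite -subr_eq0; apply/eqP.
  apply: (nrm_eps (C := 2 * nrm w)) => e e0.
  have [N /(_ N (leqnn _)) hN] := hz _ e0.
  have -> : w * z - z * w = (y N - z) * w - w * (y N - z).
    by rewrite mulrBl mulrBr (ycomm w N wx) opprB [RHS]addrC addrA addrNK.
  apply: le_trans (nrmB _ _) _.
  have h1 := nrmM (y N - z) w; have h2 := nrmM w (y N - z).
  have h3 := nrm_ge0 w; nra.
Qed.

(** As [x] and [y] commute, w = x + i y satisfies w^* w = 1, hence has norm 1, and [x] is the mean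
    of w and its adjoint. *)
Lemma circle_norm x y : star x = x -> star y = y -> x * y = y * x ->
  x * x + y * y = 1 -> nrm x <= 1.
Proof.
move=> sx sy xy h.
pose i : R[i] := 'i%C.
have ii : i * i = -1 by rewrite -expr2 sqr_i.
pose w := x + i *: y.
have ci : Num.conj i = - i by rewrite /i; apply/eqP; rewrite eq_complex /= oppr0 !eqxx.
have sw : star w = x - i *: y by rewrite starD starZ sx sy ci scaleNr.
have : star w * w = 1.
  have uu : (i *: y) * (i *: y) = - (y * y).
    by rewrite -scalerAl -scalerAr scalerA ii scaleN1r.
  have xu : x * (i *: y) = (i *: y) * x by rewrite -scalerAl -scalerAr xy.
  by rewrite sw /w mulrBl !mulrDr xu opprD addrA addrK uu opprK.
move/(congr1 (@nrm _ _)); rewrite nrm_starM nrm1 => /eqP; rewrite sqrf_eq1.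
have w0 := nrm_ge0 w.
case/orP => /eqP w1; last by rewrite w1 in w0; lra.
have -> : x = (2^-1 : R)%:C *: (w + star w).
  by rewrite sw /w addrACA subrr addr0 halfD.
rewrite nrmZr ?invr_ge0 //; have := nrmD w (star w); rewrite nrm_star w1; lra.
Qed.

(** The root y of 1 - x^2 commutes with [x] and x^2 + y^2 = 1, so y is a contraction and so is
    y^2. *)
Lemma nrm_one_sub_sqr x : star x = x -> nrm x <= 1 -> nrm (1 - x * x) <= 1.
Proof.
move=> sx x1.
have xx1 : nrm (x * x) <= 1 by rewrite -{1}sx nrm_starM expr_le1 ?nrm_ge0.
have [|z [sz z1 zz cz]] := sqrt_one_sub _ xx1; first by rewrite starMr sx.
have sy : star (1 - z) = 1 - z by rewrite starB star1 sz.
have y1 : nrm (1 - z) <= 1.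
  apply: (circle_norm (y := x)) => //; last by rewrite zz addrNK.
  by rewrite mulrBl mulrBr mul1r mulr1 cz // mulrA.
by rewrite -zz -{1}sy nrm_starM expr_le1 ?nrm_ge0.
Qed.

(** Here m = |x| and n is its square root: [sqrt_one_sub] is applied to 1 - x^2, which yields 1 -
    |x|, and then to 1 - |x|. *)
Lemma abs_square x : star x = x -> nrm x <= 1 ->
  exists m n, [/\ star m = m, star n = n, m = n * n, m * m = x * x & m * x = x * m].
Proof.
move=> sx x1.
have s1 : star (1 - x * x) = 1 - x * x by rewrite starB star1 starMr sx.
have [z [sz z1 zz cz]] := sqrt_one_sub s1 (nrm_one_sub_sqr sx x1).
have [u [su u1 uu cu]] := sqrt_one_sub sz z1.
exists (1 - z), (1 - u); split => //.
- by rewrite starB star1 sz.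
- by rewrite starB star1 su.
- by rewrite zz opprB addrC addrNK.
- rewrite mulrBl mulrBr mul1r mulr1 cz //.
  by rewrite mulrBl mulrBr mul1r mulr1 mulrA.
Qed.

End Roots.

(** * States *)

Section Conj.
Variable R : realType.
Implicit Types a b : R[i].

Lemma conjcD a b : Num.conj (a + b) = Num.conj a + Num.conj b.
Proof. exact: rmorphD. Qed.

Lemma conjcB a b : Num.conj (a - b) = Num.conj a - Num.conj b.
Proof. exact: rmorphB. Qed.

Lemma conjcM a b : Num.conj (a * b) = Num.conj a * Num.conj b.
Proof. exact: rmorphM. Qed.

Lemma conj_i : Num.conj ('i%C : R[i]) = - 'i%C.
Proof. by apply/eqP; rewrite eq_complex /= oppr0 !eqxx. Qed.

End Conj.

Section States.
Variables (R : realType) (A : cstarAlgType R) (phi : A -> R[i]).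
Hypothesis phiS : state phi.
Implicit Types x y : A.

Lemma stateL (c : R[i]) x y : phi (c *: x + y) = c * phi x + phi y.
Proof. by case: phiS => + _ _; apply. Qed.

Lemma state1 : phi 1 = 1.
Proof. by case: phiS. Qed.

Lemma state_ge0 x : 0 <= phi (star x * x).
Proof. by case: phiS. Qed.

Lemma stateD x y : phi (x + y) = phi x + phi y.
Proof. by rewrite -{1}(scale1r x) stateL mul1r. Qed.

Lemma state0 : phi 0 = 0.
Proof. by apply: (addrI (phi 0)); rewrite -stateD !addr0. Qed.

Lemma stateZ (c : R[i]) x : phi (c *: x) = c * phi x.
Proof. by rewrite -(addr0 (c *: x)) stateL state0 addr0. Qed.

Lemma stateN x : phi (- x) = - phi x.
Proof. by rewrite -scaleN1r stateZ mulN1r. Qed.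

Lemma stateB x y : phi (x - y) = phi x - phi y.
Proof. by rewrite stateD stateN. Qed.

Lemma state_sum I (r : seq I) (P : pred I) (F : I -> A) :
  phi (\sum_(i <- r | P i) F i) = \sum_(i <- r | P i) phi (F i).
Proof. by apply: (big_morph _ stateD state0). Qed.

Lemma state_sa x : star x = x -> Num.conj (phi x) = phi x.
Proof.
move=> sx.
have ge0 (y : A) : star y = y -> Num.conj (phi (y * y)) = phi (y * y).
  by move=> sy; apply/conj_Creal/ger0_real; rewrite -{1}sy state_ge0.
(* Polarization with the unit expresses [x] through squares of self-adjoint elements, where [phi] is
   real. *)
have h : phi x = (phi ((x + 1) * (x + 1)) - phi (x * x) - 1) / 2%:R.
  have -> : (x + 1) * (x + 1) = x * x + x + (x + 1).
    by rewrite mulrDl mul1r mulrDr mulr1.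
  by rewrite !stateD state1; field.
have h2 : 2%:R^-1 = (2^-1 : R)%:C by rewrite fmorphV rmorph_nat.
rewrite h h2 conjcM !conjcB conj_real !ge0 ?conjC1 //.
by rewrite starD star1 sx.
Qed.

End States.

Section Parts.
Variables (R : realType) (A : cstarAlgType R).
Implicit Types x y : A.

Definition re_part x : A := (2^-1 : R)%:C *: (x + star x).
Definition im_part x : A := - ('i%C *: ((2^-1 : R)%:C *: (x - star x))).

Lemma re_im_part x : x = re_part x + 'i%C *: im_part x.
Proof.
have ii : 'i%C * 'i%C = -1 :> R[i] by rewrite -expr2 sqr_i.
rewrite /re_part /im_part; set d := _ *: (x - star x).
rewrite scalerN scalerA ii scaleN1r opprK /d -scalerDr.
by rewrite addrACA subrr addr0 halfD.
Qed.

Lemma star_re_part x : star (re_part x) = re_part x.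
Proof. by rewrite starZr starD starK addrC. Qed.

Lemma star_im_part x : star (im_part x) = im_part x.
Proof.
by rewrite starN starZ starZr starB starK conj_i -(opprB x) !scalerN opprK scaleNr.
Qed.

Lemma nrm_re_part x : nrm (re_part x) <= nrm x.
Proof.
rewrite nrmZr ?invr_ge0 //; have := nrmD x (star x); rewrite nrm_star; lra.
Qed.

End Parts.

Section StatesStar.
Variables (R : realType) (A : cstarAlgType R) (phi : A -> R[i]).
Hypothesis phiS : state phi.
Implicit Types x y : A.

Lemma state_star x : phi (star x) = Num.conj (phi x).
Proof.
rewrite {1 2}(re_im_part x) starD star_re_part starZ star_im_part.
have E c : phi (re_part x + c *: im_part x) = phi (re_part x) + c * phi (im_part x).
  by rewrite stateD // (stateZ phiS c (im_part x)).
by rewrite !E conjcD conjcM !(state_sa phiS) ?star_re_part ?star_im_part.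
Qed.

(** After normalization to norm 1, the element 1 - x is the square of a self-adjoint element, so a
    state is nonnegative on it. *)
Lemma state_sa_le x : star x = x -> phi x <= (nrm x)%:C.
Proof.
move=> sx; have [/nrm_eq0 ->|n0] := eqVneq (nrm x) 0; first by rewrite state0 // nrm0.
have n1 : 0 < nrm x by rewrite lt_neqAle eq_sym n0 nrm_ge0.
pose y := (nrm x)^-1%:C *: x.
have sy : star y = y by rewrite starZr sx.
have y1 : nrm y <= 1 by rewrite nrmZr ?invr_ge0 ?nrm_ge0 // mulVf.
have [z [sz _ zz _]] := sqrt_one_sub sy y1.
have := state_ge0 phiS (1 - z); rewrite starB star1 sz zz stateB // state1 // subr_ge0.
rewrite stateZ // -(ler_pM2l (_ : 0 < (nrm x)%:C)) ?ltcR // mulr1 mulrA -rmorphM /=.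
by rewrite mulfV // mul1r.
Qed.

(** A phase [c] makes phi(c x) real and equal to |phi(x)|; it is then the value at the real part of
    c x, to which the self-adjoint case applies. *)
Lemma state_le x : normc (phi x) <= nrm x.
Proof.
have [c cc ch] := normc_phase (phi x).
have := state_sa_le (star_re_part (c *: x)).
have -> : phi (re_part (c *: x)) = (normc (phi x))%:C.
  rewrite !stateZ // stateD // state_star // stateZ // ch conj_real -rmorphD -rmorphM.
  by congr (_%:C); lra.
by rewrite lecR => /le_trans; apply; rewrite (le_trans (nrm_re_part _)) // nrmZ cc mul1r.
Qed.

End StatesStar.

(** * Contractivity of unital star-homomorphisms *)

Section StarHom.
Variables (R : realType) (A B : cstarAlgType R) (f : A -> B).
Hypothesis fH : unital_star_hom f.

Lemma shomD x y : f (x + y) = f x + f y.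
Proof. exact: linear_mapD (ushom_linear fH) _ _. Qed.

Lemma shomZ c x : f (c *: x) = c *: f x.
Proof. exact: linear_mapZ (ushom_linear fH) _ _. Qed.

(** A self-adjoint contraction y has a partner z with y^2 + (1 - z)^2 = 1; this relation passes
    through [f], and [circle_norm] bounds f(y). The $C^*$-identity reduces the general case to this
    one. *)
Lemma shom_nrm x : nrm (f x) <= nrm x.
Proof.
have sa (y : A) : star y = y -> nrm y <= 1 -> nrm (f y) <= 1.
  move=> sy y1.
  have yy1 : nrm (y * y) <= 1 by rewrite -{1}sy nrm_starM expr_le1 ?nrm_ge0.
  have [|z [sz z1 zz cz]] := sqrt_one_sub _ yy1; first by rewrite starMr sy.
  apply: (circle_norm (y := f (1 - z))); rewrite -?(ushom_star fH) -?(ushomM fH).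
  - by rewrite sy.
  - by rewrite starB star1 sz.
  - by rewrite mulrBl mulrBr mul1r mulr1 cz // mulrA.
  - by rewrite zz -shomD addrC addrNK (ushom1 fH).
have [/nrm_eq0 ->|n0] := eqVneq (nrm x) 0; first by rewrite (linear_map0 (ushom_linear fH)) !nrm0.
have n1 : 0 < nrm x by rewrite lt_neqAle eq_sym n0 nrm_ge0.
pose y := (nrm x)^-1%:C *: x.
have y1 : nrm y = 1 by rewrite nrmZr ?invr_ge0 ?nrm_ge0 // mulVf.
have : nrm (f y) <= 1.
  rewrite -(expr_le1 (n := 2)) ?nrm_ge0 // -nrm_starM -(ushom_star fH) -(ushomM fH).
  by apply: sa; rewrite ?starMr ?starK // nrm_starM y1 expr1n.
rewrite /y shomZ nrmZr ?invr_ge0 ?nrm_ge0 // -(ler_pM2l n1).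
by rewrite mulrA mulfV // mul1r mulr1.
Qed.

End StarHom.

(** * Positivity through faithful representations *)

Section Inner.
Variables (R : realType) (H : hilbertType R).
Implicit Types x y : H.

Lemma inner_conj x y : Num.conj (inner H x y) = inner H y x.
Proof. by rewrite [RHS]hermC expr0 mul1r. Qed.

Lemma inner_ge0 x : 0 <= inner H x x.
Proof. by rewrite inner_norm exprn_ge0. Qed.

Lemma inner_eq0 x : inner H x x = 0 -> x = 0.
Proof. by rewrite inner_norm => /eqP; rewrite sqrf_eq0 normr_eq0 => /eqP. Qed.

Lemma inner0l x : inner H 0 x = 0.
Proof. exact: linear0l. Qed.

Lemma innerDl x y z : inner H (x + y) z = inner H x z + inner H y z.
Proof. exact: linearDl. Qed.

Lemma innerZl c x y : inner H (c *: x) y = c * inner H x y.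
Proof. by rewrite linearZl_LR. Qed.

End Inner.

Section RepPositive.
Variables (R : realType) (A : cstarAlgType R) (H : hilbertType R).
Variable pi : A -> H -> H.
Hypotheses (piR : representation pi) (piI : injective pi).

Lemma reprD a b v : pi (a + b) v = pi a v + pi b v.
Proof. exact: linear_mapD (repr_linearl piR v) _ _. Qed.

Lemma repr0 v : pi 0 v = 0.
Proof. exact: linear_map0 (repr_linearl piR v). Qed.

Lemma reprZ c a v : pi (c *: a) v = c *: pi a v.
Proof. exact: linear_mapZ (repr_linearl piR v) _ _. Qed.

Lemma reprN a v : pi (- a) v = - pi a v.
Proof. by rewrite -(scaleN1r a) reprZ scaleN1r. Qed.

Lemma repr_star_l a v w : inner H (pi (star a) v) w = inner H v (pi a w).
Proof. by rewrite (repr_star piR) starK. Qed.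

Lemma repr_star_sq a v : inner H (pi (star a * a) v) v = inner H (pi a v) (pi a v).
Proof. by rewrite (reprM piR) repr_star_l. Qed.

Lemma repr_r0 a : pi a 0 = 0.
Proof. exact: linear_map0 (repr_linear piR a). Qed.

(* With m = |k| in A, the relation (m - k)(m + k) = 0 and the positivity of both
   operators force pi to kill (m - k)^2, so that k = m is a square. *)
Lemma repr_pos_square k : star k = k -> nrm k <= 1 ->
  (forall v, 0 <= inner H (pi k v) v) -> exists2 n, star n = n & k = n * n.
Proof.
move=> sk k1 pk; have [m [n [sm sn mn mm mk]]] := abs_square sk k1.
exists n => //.
suff : m - k = 0 by move/subr0_eq <-.
have h1 : (m + k) * (m - k) = 0.
  by rewrite mulrDl !mulrBr mm mk addrA subrK subrr.
have h2 v : pi ((m - k) * (m - k)) v = 0.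
  rewrite (reprM piR); set w := pi (m - k) v.
  have mkw : pi m w + pi k w = 0 by rewrite -reprD -(reprM piR) h1 repr0.
  have e : inner H (pi m w) w = inner H (pi n w) (pi n w).
    by rewrite mn -{1}sn repr_star_sq.
  have s0 : inner H (pi m w) w + inner H (pi k w) w = 0.
    by rewrite -innerDl mkw inner0l.
  have mw0 : pi m w = 0.
    rewrite mn (reprM piR) (_ : pi n w = 0) ?repr_r0 //; apply: inner_eq0.
    apply/eqP; move/eqP: s0; rewrite e paddr_eq0 ?inner_ge0 //.
    by case/andP.
  by rewrite reprD reprN mw0 add0r; move: mkw; rewrite mw0 add0r => ->; rewrite oppr0.
have h3 : (m - k) * (m - k) = 0.
  by apply: piI; apply/funext => v; rewrite h2 repr0.
apply: nrm_eq0; apply/eqP; rewrite -sqrf_eq0 -nrm_starM starB sm sk h3 nrm0 //.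
Qed.

(** A positive multiple of [k] is a contraction, hence a square by [repr_pos_square], and states are
    nonnegative on squares. *)
Lemma repr_pos_sa k phi : star k = k -> state phi ->
  (forall v, 0 <= inner H (pi k v) v) -> 0 <= phi k.
Proof.
move=> sk phiS pk; pose r := (nrm k + 1)^-1.
have k0 : 0 < nrm k + 1 by rewrite ltr_wpDl ?nrm_ge0.
have r0 : 0 < r by rewrite invr_gt0.
have [|||n sn nn] := @repr_pos_square (r%:C *: k).
- by rewrite starZr sk.
- by rewrite nrmZr ?(ltW r0) // /r mulrC ler_pdivrMr // mul1r lerDl.
- by move=> v; rewrite reprZ innerZl mulr_ge0 // lecR ltW.
have := state_ge0 phiS n; rewrite sn -nn stateZ // pmulr_rge0 //.
by rewrite ltcR.
Qed.

(** The quadratic form of [k] is real, so that of its imaginary part vanishes. That part and its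
    negative are then both positive, and every state kills it; what remains is the self-adjoint
    case. *)
Lemma repr_pos k phi : state phi ->
  (forall v, 0 <= inner H (pi k v) v) -> 0 <= phi k.
Proof.
move=> phiS pk.
have pks v : inner H (pi (star k) v) v = inner H (pi k v) v.
  by rewrite repr_star_l -inner_conj; apply/conj_Creal/ger0_real.
have h v : inner H (pi (k - star k) v) v = 0.
  by rewrite reprD reprN innerDl -scaleN1r innerZl pks mulN1r subrr.
have re0 : 0 <= phi (re_part k).
  apply: repr_pos_sa => // [|v]; first exact: star_re_part.
  rewrite /re_part reprZ innerZl reprD innerDl pks mulr_ge0 ?addr_ge0 //.
  by rewrite lecR invr_ge0.
have im0 : phi (im_part k) = 0.
  have e v : inner H (pi (im_part k) v) v = 0.
    by rewrite /im_part reprN !reprZ -scaleN1r !innerZl h !mulr0.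
  apply/eqP; rewrite eq_le -oppr_ge0 -stateN // !repr_pos_sa //.
  - exact: star_im_part.
  - by move=> v; rewrite e.
  - by rewrite starN star_im_part.
  - by move=> v; rewrite reprN -scaleN1r innerZl e mulr0.
by rewrite (re_im_part k) stateD // (stateZ phiS _ (im_part k)) im0 mulr0 addr0.
Qed.

End RepPositive.

(** * Product states *)

Section TensorForm.
Variables (R : realType) (H K : hilbertType R).
Implicit Types s t : seq (H * K).

(** The inner product of the Hilbert space tensor product, on lists of elementary tensors;
    [tensor_norm t] is the square root of its value at [t], [t]. *)
Definition tform s t : R[i] :=
  \sum_(p <- s) \sum_(q <- t) inner H p.1 q.1 * inner K p.2 q.2.

Lemma tform_catl s1 s2 t : tform (s1 ++ s2) t = tform s1 t + tform s2 t.
Proof. by rewrite /tform big_cat. Qed.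

Lemma tform_catr s t1 t2 : tform s (t1 ++ t2) = tform s t1 + tform s t2.
Proof. by rewrite /tform -big_split; apply: eq_bigr => p _; rewrite big_cat. Qed.

Lemma tform_conj s t : Num.conj (tform s t) = tform t s.
Proof.
rewrite /tform exchange_big rmorph_sum; apply: eq_bigr => p _.
rewrite rmorph_sum; apply: eq_bigr => q _.
by rewrite rmorphM /= !inner_conj.
Qed.

(* Gram-Schmidt: splitting off the components of the second factors along the
   first of them leaves a shorter list. *)
Lemma tform_ge0 t : 0 <= tform t t.
Proof.
have [n] := ubnP (size t); elim: n t => // n IHn [|[u v] t] /=; first by rewrite /tform big_nil.
rewrite ltnS => tn.
have [v0|v0] := eqVneq v 0.
  have -> : tform ((u, v) :: t) ((u, v) :: t) = tform t t; last exact: IHn.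
  have l s : tform [:: (u, v)] s = 0.
    by rewrite /tform big_seq1 big1 // => q _; rewrite /= v0 inner0l mulr0.
  have r s : tform s [:: (u, v)] = 0 by rewrite -tform_conj l conjC0.
  by rewrite -cat1s tform_catl !tform_catr !l r !add0r.
have w0 : inner K v v != 0 by apply: contra v0 => /eqP /inner_eq0 ->.
pose c p := inner K p v / inner K v v.
pose t' := [seq (p.1, p.2 - c p.2 *: v) | p <- t].
have cv : c v = 1 by rewrite /c mulfV.
pose s := (u, v) :: t.
have vv : Num.conj (inner K v v) = inner K v v by rewrite inner_conj.
(* Orthogonal decomposition of the second factors along [v]: the component along [v] plus what
   remains after projection. *)
have key p q : inner K p q = c p * Num.conj (c q) * inner K v v +
    inner K (p - c p *: v) (q - c q *: v).
  have nb x y z : inner K (x - y) z = inner K x z - inner K y z.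
    by rewrite innerDl -scaleN1r innerZl mulN1r.
  have nbr x y z : inner K z (x - y) = inner K z x - inner K z y.
    by rewrite -inner_conj nb conjcB !inner_conj.
  have Zr x y d : inner K y (d *: x) = Num.conj d * inner K y x.
    by rewrite -inner_conj innerZl conjcM inner_conj.
  have ic x : inner K v x = Num.conj (c x) * inner K v v.
    by rewrite /c -inner_conj -{2}vv -conjcM mulfVK.
  rewrite nb !nbr !innerZl !Zr (ic q).
  have -> : inner K p v = c p * inner K v v by rewrite /c mulfVK.
  by ring.
pose U := \sum_(p <- s) c p.2 *: p.1.
have -> : tform s s = inner K v v * inner H U U + tform t' t'.
  (* Projecting the head (u, v) of [s] gives (u, 0), which contributes nothing; with it in place
     both sides are sums over [s]. *)
  have -> : tform t' t' = tform ((u, 0) :: t') ((u, 0) :: t').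
    have l r : tform [:: (u, 0)] r = 0.
      by rewrite /tform big_seq1 big1 // => q _; rewrite /= inner0l mulr0.
    have r r : tform r [:: (u, 0)] = 0 by rewrite -tform_conj l conjC0.
    by rewrite -(cat1s _ t') tform_catl !tform_catr !l r !add0r.
  have -> : (u, 0) :: t' = [seq (p.1, p.2 - c p.2 *: v) | p <- s].
    by rewrite /s /= cv scale1r subrr.
  have UU : inner H U U = \sum_(p <- s) \sum_(q <- s) c p.2 * Num.conj (c q.2) * inner H p.1 q.1.
    have iS x : inner H U x = \sum_(p <- s) c p.2 * inner H p.1 x.
      rewrite /U (big_morph (fun y => inner H y x) (id1 := 0) (op1 := +%R)).
      - by apply: eq_bigr => p _; rewrite innerZl.
      - by move=> y z; rewrite innerDl.
      - exact: inner0l.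
    rewrite iS; apply: eq_bigr => p _; rewrite -inner_conj iS rmorph_sum mulr_sumr.
    by apply: eq_bigr => q _; rewrite rmorphM /= inner_conj mulrA.
  rewrite UU /tform [in RHS]big_map mulr_sumr -big_split; apply: eq_bigr => p _.
  rewrite [in RHS]big_map mulr_sumr -big_split; apply: eq_bigr => q _ /=.
  by rewrite (key p.2 q.2); ring.
rewrite addr_ge0 ?mulr_ge0 ?inner_ge0 //; apply: IHn.
by rewrite size_map.
Qed.

Lemma tformE t : tform t t = (complex.Re (tform t t))%:C.
Proof. by apply/esym/RRe_real/ger0_real/tform_ge0. Qed.

Lemma tensor_normE t : tensor_norm t = Num.sqrt (complex.Re (tform t t)).
Proof. by []. Qed.

(** The parallelogram identity: the difference of the two sides is the form of s - t, where [t'] is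
    the negative of [t]. *)
Lemma tform_cat_le s t : tform (s ++ t) (s ++ t) <= 2%:R * (tform s s + tform t t).
Proof.
pose t' := [seq (- p.1, p.2) | p <- t].
have l r : tform t' r = - tform t r.
  rewrite /tform big_map -sumrN; apply: eq_bigr => p _.
  by rewrite -sumrN; apply: eq_bigr => q _ /=; rewrite -scaleN1r innerZl mulN1r mulNr.
have r r : tform r t' = - tform r t by rewrite -tform_conj l rmorphN /= tform_conj.
have := tform_ge0 (s ++ t'); rewrite !tform_catl !tform_catr !l !r => h.
rewrite -subr_ge0; apply: le_trans h _; rewrite le_eqVlt; apply/orP; left; apply/eqP.
ring.
Qed.

(** Cauchy-Schwarz against the unit vector e = u (x) v, from the positivity of the form at s - z e
    with z = <s, e>. *)
Lemma tform_elem_le s u v : inner H u u = 1 -> inner K v v = 1 ->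
  normc (tform s [:: (u, v)]) <= tensor_norm s.
Proof.
move=> u1 v1; set e := [:: (u, v)]; set z := tform s e.
pose e' := [:: (- z *: u, v)].
have l r : tform e' r = - z * tform e r.
  rewrite /tform !big_seq1 mulr_sumr; apply: eq_bigr => q _ /=.
  by rewrite innerZl mulrA.
have r r : tform r e' = - Num.conj z * tform r e.
  by rewrite -tform_conj l conjcM tform_conj rmorphN.
have ee : tform e e = 1 by rewrite /tform !big_seq1 u1 v1 mul1r.
have := tform_ge0 (s ++ e'); rewrite tform_catl !tform_catr !l !r ee.
rewrite -(tform_conj s e) -/z => h.
have : z * Num.conj z <= tform s s.
  rewrite -subr_ge0; apply: le_trans h _; rewrite le_eqVlt; apply/orP; left; apply/eqP.
  ring.
rewrite -normCK (_ : `|z| = (normc z)%:C) // tformE -rmorphXn lecR => h2.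
rewrite tensor_normE -(ger0_norm (normc_ge0 z)) -sqrtr_sqr ler_wsqrtr //.
Qed.

End TensorForm.

Lemma inner_nrm (R : realType) (H : hilbertType R) (v : H) : inner H v v = (nrm v ^+ 2)%:C.
Proof. by rewrite inner_norm nrmE -rmorphXn. Qed.

Lemma unit_normalize (R : realType) (H : hilbertType R) (v : H) : v != 0 ->
  exists2 w, inner H w w = 1 & v = (nrm v)%:C *: w.
Proof.
move=> v0; have n0 : nrm v != 0 by apply: contra v0 => /eqP/nrm_eq0 ->.
exists ((nrm v)^-1%:C *: v).
  by rewrite inner_nrm nrmZr ?invr_ge0 ?nrm_ge0 // mulVf // expr1n.
by rewrite scalerA -rmorphM /= mulfV // scale1r.
Qed.

Section RepBound.
Variables (R : realType) (A : cstarAlgType R) (H K : hilbertType R).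
Variable pi : A -> H -> H.
Hypothesis piR : representation pi.

(** Boundedness of pi(a) (x) 1. With b = a / N a contraction, some self-adjoint d has b^* b + d^2 =
    1, so the form at [t] is the sum of the nonnegative forms at the images of [t] under b and d;
    the constant is N^2. *)
Lemma tform_repr_le a : exists2 C : R, 0 <= C & forall t : seq (H * K),
  let t' := [seq (pi a q.1, q.2) | q <- t] in tform t' t' <= C%:C * tform t t.
Proof.
pose N := nrm a + 1; have N0 : 0 < N by rewrite ltr_wpDl ?nrm_ge0.
pose b := N^-1%:C *: a.
have aE : a = N%:C *: b by rewrite scalerA -rmorphM /= mulfV ?gt_eqF // scale1r.
have b1 : nrm b <= 1.
  by rewrite nrmZr ?invr_ge0 ?(ltW N0) // mulrC ler_pdivrMr // mul1r lerDl.
have [||y [sy _ yy _]] := @sqrt_one_sub _ _ (star b * b).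
- by rewrite starMr starK.
- by rewrite nrm_starM expr_le1 ?nrm_ge0.
set d := 1 - y in yy; have sd : star d = d by rewrite starB star1 sy.
exists (N ^+ 2) => [|t]; first by rewrite sqr_ge0.
have E v w : inner H v w = inner H (pi b v) (pi b w) + inner H (pi d v) (pi d w).
  rewrite -[in RHS](repr_star_l piR) -[in X in _ + X](repr_star_l piR) -!(reprM piR).
  by rewrite -innerDl -(reprD piR) sd yy addrC subrK (repr1 piR).
have aa v w : inner H (pi a v) (pi a w) = (N ^+ 2)%:C * inner H (pi b v) (pi b w).
  rewrite aE !(reprZ piR) innerZl -inner_conj innerZl conjcM conj_real inner_conj.
  by rewrite mulrA -rmorphM -expr2.
pose tt c := [seq (pi c q.1, q.2) | q <- t].
have -> : tform t t = tform (tt b) (tt b) + tform (tt d) (tt d).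
  rewrite /tform /tt !big_map -big_split; apply: eq_bigr => p _.
  rewrite !big_map -big_split; apply: eq_bigr => q _ /=.
  by rewrite (E p.1 q.1) mulrDl.
cbv zeta; rewrite -/(tt a).
have -> : tform (tt a) (tt a) = (N ^+ 2)%:C * tform (tt b) (tt b).
  rewrite /tform /tt !big_map mulr_sumr; apply: eq_bigr => p _.
  rewrite !big_map mulr_sumr; apply: eq_bigr => q _ /=.
  by rewrite aa mulrA.
rewrite ler_wpM2l ?lecR ?sqr_ge0 //.
by rewrite lerDl tform_ge0.
Qed.

End RepBound.

Lemma tform_swap (R : realType) (H K : hilbertType R) (s t : seq (H * K)) :
  tform [seq (p.2, p.1) | p <- s] [seq (p.2, p.1) | p <- t] = tform s t.
Proof.
rewrite /tform !big_map; apply: eq_bigr => p _; rewrite big_map.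
by apply: eq_bigr => q _; rewrite mulrC.
Qed.

(** * Product vector functionals and the spatial norm *)

Section SpatialNorm.
Variables (R : realType) (A B : cstarAlgType R) (H K : hilbertType R).
Variables (pi : A -> H -> H) (rho : B -> K -> K).
Hypotheses (piR : representation pi) (rhoR : representation rho).

(** This makes the set in [spatial_norm] bounded above, so that its members lie below the
    supremum. *)
Lemma tensor_act_le x : exists2 C : R, 0 <= C & forall t : seq (H * K),
  let t' := tensor_act pi rho x t in tform t' t' <= C%:C * tform t t.
Proof.
elim: x => [|[a b] x [C C0 hC]].
  by exists 0 => // t; rewrite /= /tform big_nil mul0r.
have [Ca Ca0 ha] := tform_repr_le K piR a.
have [Cb Cb0 hb] := tform_repr_le H rhoR b.
exists (2 * (Cb * Ca + C)) => [|t]; first by rewrite mulr_ge0 // addr_ge0 // mulr_ge0.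
rewrite /tensor_act /=; apply: le_trans (tform_cat_le _ _) _.
rewrite -(rmorph_nat (real_complex R)) rmorphM -mulrA ler_wpM2l ?lecR //.
rewrite rmorphD mulrDl; apply: lerD; last exact: hC.
pose t1 := [seq (pi a q.1, q.2) | q <- t].
have -> : [seq (pi a q.1, rho b q.2) | q <- t] = [seq (q.1, rho b q.2) | q <- t1].
  by rewrite -map_comp.
(* Exchanging the two factors lets the bound for pi(a) (x) 1 serve for 1 (x) rho(b). *)
pose t2 := [seq (p.2, p.1) | p <- t1].
have := hb t2; rewrite /= -[X in _ <= X]/(_ * _) {2}/t2 tform_swap.
have -> : [seq (rho b q.1, q.2) | q <- t2] =
    [seq (p.2, p.1) | p <- [seq (q.1, rho b q.2) | q <- t1]].
  by rewrite /t2 -!map_comp.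
rewrite tform_swap => /le_trans; apply.
by rewrite rmorphM -mulrA ler_wpM2l ?lecR //; exact: ha.
Qed.

Lemma spatial_norm_elem x u v : inner H u u = 1 -> inner K v v = 1 ->
  normc (\sum_(p <- x) inner H (pi p.1 u) u * inner K (rho p.2 v) v)
    <= spatial_norm pi rho x.
Proof.
move=> u1 v1.
have -> : \sum_(p <- x) inner H (pi p.1 u) u * inner K (rho p.2 v) v =
    tform (tensor_act pi rho x [:: (u, v)]) [:: (u, v)].
  elim: x => [|p x ih]; first by rewrite /tform !big_nil.
  by rewrite big_cons ih /tensor_act /= /tform big_cons big_seq1.
apply: le_trans (tform_elem_le _ u1 v1) _.
have [C C0 hC] := tensor_act_le x.
apply: ub_le_sup.
  exists (Num.sqrt C) => _ [t /= t1 <-].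
  rewrite tensor_normE ler_wsqrtr // -lecR -tformE (le_trans (hC t)) //.
  rewrite -[leRHS]mulr1 ler_wpM2l ?lecR // tformE lecR.
  move: t1; rewrite tensor_normE -{1}sqrtr1 ler_sqrt //.
exists [:: (u, v)] => //=.
by rewrite tensor_normE /tform !big_seq1 u1 v1 mul1r sqrtr1.
Qed.

Lemma spatial_norm_vect x u v :
  normc (\sum_(p <- x) inner H (pi p.1 u) u * inner K (rho p.2 v) v)
    <= spatial_norm pi rho x * (nrm u ^+ 2 * nrm v ^+ 2).
Proof.
have [->|u0] := eqVneq u 0.
  rewrite big1 => [|p _]; last by rewrite (repr_r0 piR) inner0l mul0r.
  by rewrite normc0 nrm0 expr0n mul0r mulr0.
have [->|v0] := eqVneq v 0.
  rewrite big1 => [|p _]; last by rewrite (repr_r0 rhoR) inner0l mulr0.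
  by rewrite normc0 nrm0 expr0n !mulr0.
have [u' u1 uE] := unit_normalize u0; have [v' v1 vE] := unit_normalize v0.
have quad (L : hilbertType R) (f : L -> L) (r : R) w : linear f ->
    inner L (f (r%:C *: w)) (r%:C *: w) = (r ^+ 2)%:C * inner L (f w) w.
  move=> fl; rewrite (linear_mapZ fl).
  rewrite innerZl -inner_conj innerZl conjcM conj_real inner_conj.
  by rewrite mulrA -rmorphM -expr2.
have -> : \sum_(p <- x) inner H (pi p.1 u) u * inner K (rho p.2 v) v =
    (nrm u ^+ 2 * nrm v ^+ 2)%:C *
    \sum_(p <- x) inner H (pi p.1 u') u' * inner K (rho p.2 v') v'.
  rewrite mulr_sumr; apply: eq_bigr => p _.
  rewrite {1 2}uE {1 2}vE (quad _ _ _ _ (repr_linear piR _)).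
  rewrite (quad _ _ _ _ (repr_linear rhoR _)) rmorphM; ring.
rewrite normc_mul normc_real ger0_norm; last by rewrite mulr_ge0 ?sqr_ge0.
rewrite mulrC.
by apply: ler_wpM2r; [rewrite mulr_ge0 ?sqr_ge0|exact: spatial_norm_elem].
Qed.

End SpatialNorm.

(** * Extension of product functionals to the tensor product *)

Section ProductState.
Variables (R : realType) (A B T : cstarAlgType R) (tens : A -> B -> T).
Hypothesis tensP : spatial_tensor tens.
Implicit Types s : seq (A * B).

Definition tsum s : T := \sum_(p <- s) tens p.1 p.2.
Definition tscale (c : R[i]) s := [seq (c *: p.1, p.2) | p <- s].
(** The product functional is first defined on lists; for states, [tval_le] shows that it depends
    only on the element [tsum s]. *)
Definition tval (phi : A -> R[i]) (psi : B -> R[i]) s := \sum_(p <- s) phi p.1 * psi p.2.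

Lemma tensZl c a b : tens (c *: a) b = c *: tens a b.
Proof. exact: linear_mapZ (tens_linearl tensP b) _ _. Qed.

Lemma tsum_cat s t : tsum (s ++ t) = tsum s + tsum t.
Proof. exact: big_cat. Qed.

Lemma tsum_scale c s : tsum (tscale c s) = c *: tsum s.
Proof. by rewrite /tsum big_map scaler_sumr; apply: eq_bigr => p _; rewrite tensZl. Qed.

Lemma tsum_dense x (e : R) : 0 < e -> exists s, nrm (x - tsum s) < e.
Proof.
move=> e0; have [y [n [c [z [hz ->]]]] hy] := dense_nrm (tens_dense tensP) x e0.
suff [s hs] : exists s, \sum_(i < n) c i *: z i = tsum s by exists s; rewrite -hs.
apply: (big_ind (fun v => exists s, v = tsum s)).
- by exists [::]; rewrite /tsum big_nil.
- by move=> _ _ [s ->] [t ->]; exists (s ++ t); rewrite tsum_cat.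
- move=> i _; have [a [b ->]] := hz i.
  by exists [:: (c i *: a, b)]; rewrite /tsum big_seq1 tensZl.
Qed.

Section Values.
Variables (phi : A -> R[i]) (psi : B -> R[i]).
Hypotheses (phiS : state phi) (psiS : state psi).

Lemma tval_cat s t : tval phi psi (s ++ t) = tval phi psi s + tval phi psi t.
Proof. exact: big_cat. Qed.

Lemma tval_scale c s : tval phi psi (tscale c s) = c * tval phi psi s.
Proof.
by rewrite /tval big_map mulr_sumr; apply: eq_bigr => p _; rewrite stateZ // mulrA.
Qed.

(* Positivity is first transferred from the vector states of A, then from those of B. *)
Lemma tval_repr_ge0 (H K : hilbertType R) (pi : A -> H -> H) (rho : B -> K -> K) s :
  representation pi -> injective pi -> representation rho -> injective rho ->
  (forall u v, 0 <= \sum_(p <- s) inner H (pi p.1 u) u * inner K (rho p.2 v) v) ->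
  0 <= tval phi psi s.
Proof.
move=> piR piI rhoR rhoI h.
pose b := \sum_(p <- s) phi p.1 *: p.2.
have -> : tval phi psi s = psi b.
  by rewrite /b state_sum //; apply: eq_bigr => p _; rewrite stateZ.
apply: (repr_pos rhoR rhoI psiS) => v.
pose a := \sum_(p <- s) inner K (rho p.2 v) v *: p.1.
have reprS (C : cstarAlgType R) (L : hilbertType R) (sigma : C -> L -> L) w
    (c : A * B -> R[i]) (f : A * B -> C) :
    representation sigma -> inner L (sigma (\sum_(p <- s) c p *: f p) w) w =
    \sum_(p <- s) c p * inner L (sigma (f p) w) w.
  move=> sR; rewrite (big_morph (fun y => inner L (sigma y w) w) (id1 := 0) (op1 := +%R)).
  - by apply: eq_bigr => p _; rewrite reprZ // innerZl.
  - by move=> y z; rewrite reprD // innerDl.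
  - by rewrite repr0 // inner0l.
have -> : inner K (rho b v) v = phi a.
  rewrite reprS // state_sum //; apply: eq_bigr => p _.
  by rewrite stateZ // mulrC.
apply: (repr_pos piR piI phiS) => u; rewrite reprS //.
by under eq_bigr do rewrite mulrC.
Qed.

(** Let x be [tsum s], M its norm, and c a phase with c z = |z|. The list [s'] stands for M 1 - Re(c
    x). Product vector functionals are nonnegative on it, since they are bounded by M |u|^2 |v|^2 on
    x; hence so is the product of the two states, whose value there is M - |z|. *)
Lemma tval_le s : normc (tval phi psi s) <= nrm (tsum s).
Proof.
have [H [K [pi [rho [piR piI rhoR rhoI nE]]]]] := tens_norm tensP.
have nE' : nrm (tsum s) = spatial_norm pi rho s by rewrite /nrm nE.
set z := tval phi psi s; set M := nrm (tsum s).
have [c c1 cz] := normc_phase z.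
pose h : R[i] := (2^-1 : R)%:C.
have h2 : h + h = 1 by rewrite -rmorphD; congr (_%:C); lra.
pose s' := (M%:C *: 1, 1) :: tscale (- (h * c)) s ++
  [seq ((- (h * Num.conj c)) *: star p.1, star p.2) | p <- s].
have : 0 <= tval phi psi s'.
  apply: (tval_repr_ge0 piR piI rhoR rhoI) => u v.
  set w := \sum_(p <- s) inner H (pi p.1 u) u * inner K (rho p.2 v) v.
  have -> : \sum_(p <- s') inner H (pi p.1 u) u * inner K (rho p.2 v) v =
      (M * (nrm u ^+ 2 * nrm v ^+ 2))%:C - h * (c * w + Num.conj (c * w)).
    rewrite /s' big_cons big_cat /= /tscale !big_map /=.
    rewrite reprZ // !repr1 // innerZl !inner_nrm -mulrA -!rmorphM; congr (_ + _).
    rewrite conjcM mulrDr opprD; congr (_ + _).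
      rewrite [in RHS]mulrA -[in RHS]mulNr /w mulr_sumr; apply: eq_bigr => p _.
      by rewrite reprZ // innerZl mulrA.
    rewrite [in RHS]mulrA -[in RHS]mulNr /w conjc_sum mulr_sumr; apply: eq_bigr => p _.
    by rewrite reprZ // innerZl !repr_star_l // -mulrA conjcM !inner_conj.
  have hw : normc (c * w) <= M * (nrm u ^+ 2 * nrm v ^+ 2).
    by rewrite normc_mul c1 mul1r /M nE'; exact: spatial_norm_vect.
  have -> : h * (c * w + Num.conj (c * w)) = (complex.Re (c * w))%:C.
    have -> : Num.conj (c * w) = (c * w)^*%C by [].
    rewrite addcJ mulrA (_ : h * 2%:R = 1) ?mul1r //.
    by rewrite mulr_natr mulr2n.
  rewrite -rmorphB ler0c subr_ge0; apply: le_trans hw.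
  by apply: le_trans (Re_le_normc _); exact: ler_norm.
have -> : tval phi psi s' = (M - normc z)%:C.
  rewrite /tval big_cons big_cat /= /tscale !big_map /=.
  rewrite stateZ // !state1 // !mulr1 rmorphB; congr (_ + _).
  have -> : \sum_(p <- s) phi (- (h * c) *: p.1) * psi p.2 = - (h * (normc z)%:C).
    rewrite -cz [in RHS]mulrA -[in RHS]mulNr /z /tval mulr_sumr; apply: eq_bigr => p _.
    by rewrite stateZ // mulrA.
  have -> : \sum_(p <- s) phi (- (h * Num.conj c) *: star p.1) * psi (star p.2) =
      - (h * (normc z)%:C).
    rewrite -(conj_real (normc z)) -cz conjcM [in RHS]mulrA -[in RHS]mulNr /z /tval conjc_sum mulr_sumr.
    by apply: eq_bigr => p _; rewrite stateZ // !state_star // -mulrA -conjcM.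
  by rewrite -opprD -mulrDl h2 mul1r.
by rewrite ler0c subr_ge0.
Qed.

Definition tsquare s := [seq (star p.1 * q.1, star p.2 * q.2) | p <- s, q <- s].

Lemma tsum_square s : tsum (tsquare s) = star (tsum s) * tsum s.
Proof.
rewrite /tsum /tsquare big_allpairs_dep star_sum mulr_suml; apply: eq_bigr => p _.
rewrite mulr_sumr; apply: eq_bigr => q _ /=.
by rewrite (tens_star tensP) (tensM tensP).
Qed.

Lemma tval_square_ge0 s : 0 <= tval phi psi (tsquare s).
Proof.
have [H [K [pi [rho [piR piI rhoR rhoI nE]]]]] := tens_norm tensP.
apply: (tval_repr_ge0 piR piI rhoR rhoI) => u v.
have -> : \sum_(p <- tsquare s) inner H (pi p.1 u) u * inner K (rho p.2 v) v =
    let m := [seq (pi p.1 u, rho p.2 v) | p <- s] in tform m m; last exact: tform_ge0.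
rewrite /tform /tsquare big_allpairs_dep [RHS]exchange_big big_map; apply: eq_bigr => p _.
rewrite big_map; apply: eq_bigr => q _ /=.
by rewrite !reprM // !repr_star_l.
Qed.

(** By [tval_le] the values are 1-Lipschitz in [tsum s], which runs over a dense set. Real and
    imaginary parts are extended separately, whence the factor 2; linearity follows by
    approximation. *)
Lemma tval_extend : exists F : T -> R[i], [/\ scalar F,
  forall s, F (tsum s) = tval phi psi s & forall x y, normc (F x - F y) <= 2 * nrm (x - y)].
Proof.
have tvB s t : normc (tval phi psi s - tval phi psi t) <= nrm (tsum s - tsum t).
  have -> : tval phi psi s - tval phi psi t = tval phi psi (s ++ tscale (-1) t).
    by rewrite tval_cat tval_scale mulN1r.
  by rewrite (le_trans (tval_le _)) // tsum_cat tsum_scale scaleN1r.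
(* McShane's extension of a 1-Lipschitz real function. *)
have ext (g : seq (A * B) -> R) : (forall s t, `|g s - g t| <= nrm (tsum s - tsum t)) ->
    forall x, exists r, forall s, `|r - g s| <= nrm (x - tsum s).
  move=> gl x; pose E := [set g s + nrm (x - tsum s) | s in setT].
  have lb s : lbound E (g s - nrm (x - tsum s)).
    move=> _ [t _ <-]; have := gl s t; have := ler_norm (g s - g t).
    have := nrm_tri x (tsum s) (tsum t); rewrite (nrmBC (tsum s) x); lra.
  exists (inf E) => s; rewrite ler_distlC; apply/andP; split.
    rewrite lerBlDr; apply: ge_inf; last by exists s.
    by exists (g s - nrm (x - tsum s)).
  rewrite -lerBlDr; apply: lb_le_inf => //.
  by exists (g s + nrm (x - tsum s)); exists s.
have /choice[F hF] x : exists z, forall s, normc (z - tval phi psi s) <= 2 * nrm (x - tsum s).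
  have hRe s t : `|complex.Re (tval phi psi s) - complex.Re (tval phi psi t)| <= nrm (tsum s - tsum t).
    by rewrite -raddfB; apply: le_trans (tvB s t); exact: Re_le_normc.
  have hIm s t : `|complex.Im (tval phi psi s) - complex.Im (tval phi psi t)| <= nrm (tsum s - tsum t).
    by rewrite -raddfB; apply: le_trans (tvB s t); exact: Im_le_normc.
  have [r1 h1] := ext _ hRe x; have [r2 h2] := ext _ hIm x.
  exists (r1 +i* r2) => s; apply: le_trans (normc_le_ReIm _) _.
  rewrite !raddfB /=; have := h1 s; have := h2 s; lra.
have FE s : F (tsum s) = tval phi psi s.
  apply/eqP; rewrite -subr_eq0; apply/eqP; apply: eq0_normc; apply/eqP.
  by rewrite eq_le normc_ge0 andbT (le_trans (hF _ s)) // subrr nrm0 mulr0.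
exists F; split=> //.
- move=> c x y; apply/eqP; rewrite -subr_eq0; apply/eqP.
  apply: (@normc_eps _ _ (4 * (normc c + 1))) => e e0.
  have [s hs] := tsum_dense x e0; have [t ht] := tsum_dense y e0.
  have h1 := hF (c *: x + y) (tscale c s ++ t).
  rewrite tsum_cat tsum_scale tval_cat tval_scale in h1.
  have E : c *: x + y - (c *: tsum s + tsum t) = c *: (x - tsum s) + (y - tsum t).
    by rewrite opprD addrACA -scalerBr.
  rewrite E in h1.
  have h2 := hF x s; have h3 := hF y t.
  have h4 := nrmD (c *: (x - tsum s)) (y - tsum t); rewrite nrmZ in h4.
  set v := F (c *: x + y) in h1 *; set a := tval phi psi s in h1 h2; set b := tval phi psi t in h1 h3.
  have -> : v - (c * F x + F y) = (v - (c * a + b)) + (c * (a - F x) + (b - F y)) by ring.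
  have h5 := normc_add (v - (c * a + b)) (c * (a - F x) + (b - F y)).
  have h6 := normc_add (c * (a - F x)) (b - F y).
  rewrite normc_mul (normc_subC a) (normc_subC b) in h6.
  have c0 := normc_ge0 c.
  have := normc_ge0 (F x - a); have := nrm_ge0 (x - tsum s).
  nra.
- move=> x y; rewrite -subr_le0; apply: (@le0_eps _ _ 4) => e e0.
  have [s hs] := tsum_dense x e0.
  have h1 := hF x s; have h2 := hF y s.
  have := normc_tri (tval phi psi s) (F x) (F y); rewrite (normc_subC (tval _ _ _)).
  have := nrm_tri x y (tsum s); rewrite (nrmBC y x); lra.
Qed.

Lemma tstate_exists : exists F : T -> R[i],
  state F /\ forall a b, F (tens a b) = phi a * psi b.
Proof.
have [F [Fl FE FL]] := tval_extend.
have Ft a b : F (tens a b) = phi a * psi b.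
  by have := FE [:: (a, b)]; rewrite /tsum /tval !big_seq1.
exists F; split=> //; split=> // [x|]; last by rewrite -(tens1 tensP) Ft !state1 // mulr1.
apply: (@ge0_eps _ _ (2 * (2 * nrm x + 1))) => e e0.
(* Capping the error at 1 keeps the approximant of norm at most [nrm x + 1], so that the constant
   depends on [x] only. *)
have e1 : 0 < Num.min e 1 by rewrite lt_min e0 ltr01.
have [s] := tsum_dense x e1; rewrite lt_min => /andP[hs hs1].
exists (tval phi psi (tsquare s)); first exact: tval_square_ge0.
rewrite -FE tsum_square; apply: le_trans (FL _ _) _.
have -> : star x * x - star (tsum s) * tsum s =
    star (x - tsum s) * x + star (tsum s) * (x - tsum s).
  by rewrite starB mulrBl mulrBr addrA subrK.
have h1 := nrmD (star (x - tsum s) * x) (star (tsum s) * (x - tsum s)).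
have h2 := nrmM (star (x - tsum s)) x; have h3 := nrmM (star (tsum s)) (x - tsum s).
rewrite !nrm_star in h2 h3.
have h4 := nrmD x (tsum s - x); rewrite addrC subrK (nrmBC (tsum s)) in h4.
have := nrm_ge0 x; have := nrm_ge0 (x - tsum s); have := nrm_ge0 (tsum s); nra.
Qed.

End Values.

Lemma tens_ext (f g : T -> R[i]) : scalar f -> scalar g ->
  (forall x (e : R), 0 < e -> exists2 d : R, 0 < d &
     forall y, nrm (x - y) < d -> normc (f x - f y) < e /\ normc (g x - g y) < e) ->
  (forall a b, f (tens a b) = g (tens a b)) -> f =1 g.
Proof.
move=> fl gl fg h x; apply/eqP; rewrite -subr_eq0; apply/eqP.
apply: (@normc_eps _ _ 2) => e e0; have [d d0 hd] := fg x e e0.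
have [s /hd [h1 h2]] := tsum_dense x d0.
have sum (k : T -> R[i]) : scalar k -> k (tsum s) = \sum_(p <- s) k (tens p.1 p.2).
  by move=> kl; apply: (big_morph k (linear_mapD kl) (linear_map0 kl)).
have E : f (tsum s) = g (tsum s) by rewrite !sum //; apply: eq_bigr => p _.
have := normc_tri (f (tsum s)) (f x) (g x); rewrite {2}E (normc_subC (g (tsum s))); lra.
Qed.

Lemma state_tens_ext (f g : T -> R[i]) : state f -> state g ->
  (forall a b, f (tens a b) = g (tens a b)) -> f =1 g.
Proof.
move=> fS gS; apply: tens_ext; first by case: fS.
  by case: gS.
move=> x e e0; exists e => // y xy.
by split; rewrite -stateB //; apply: le_lt_trans xy; exact: state_le.
Qed.

(** For states [phi] and [psi] such an [F] exists by [tstate_exists] and is unique by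
    [state_tens_ext]; it is the product state. *)
Definition tstate (phi : A -> R[i]) (psi : B -> R[i]) : T -> R[i] :=
  xget (fun=> 0) [set F | state F /\ forall a b, F (tens a b) = phi a * psi b].

Lemma tstateP phi psi : state phi -> state psi ->
  state (tstate phi psi) /\ forall a b, tstate phi psi (tens a b) = phi a * psi b.
Proof.
move=> phiS psiS; have [F FP] := tstate_exists phiS psiS.
by rewrite /tstate; case: xgetP => [G _ //|/(_ F)].
Qed.

End ProductState.

(** * Convolution of states *)

Section StateTens.
Variables (R : realType) (A B T : cstarAlgType R) (tens : A -> B -> T).
Hypothesis tensP : spatial_tensor tens.

Lemma tstate_unique phi psi F : state phi -> state psi -> state F ->
  (forall a b, F (tens a b) = phi a * psi b) -> F = tstate tens phi psi.
Proof.
move=> phiS psiS FS FE; have [tS tE] := tstateP tensP phiS psiS.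
by apply/funext/(state_tens_ext tensP) => // a b; rewrite FE tE.
Qed.

(** Factor x (x) b as x (x) 1 times 1 (x) b; the map sending x to x (x) 1 is a unital
    star-homomorphism, hence contractive. This gives continuity in the first variable. *)
Lemma tens_nrml_le x b : nrm (tens x b) <= nrm x * nrm (tens 1 b).
Proof.
rewrite -(mulr1 x) -(mul1r b) -(tensM tensP) mulr1 mul1r (le_trans (nrmM _ _)) //.
apply: ler_wpM2r; first exact: nrm_ge0.
have h : unital_star_hom (tens^~ 1).
  split=> [|y z||y].
  - exact: tens_linearl.
  - by rewrite (tensM tensP) mulr1.
  - exact: tens1.
  - by rewrite (tens_star tensP) star1.
exact: (shom_nrm h).
Qed.

End StateTens.

Lemma state_comp (R : realType) (A B : cstarAlgType R) (f : A -> B) phi :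
  unital_star_hom f -> state phi -> state (phi \o f).
Proof.
move=> fH phiS; split=> [c x y|x|] /=.
- by rewrite (ushom_linear fH) stateL.
- by rewrite (ushomM fH) (ushom_star fH) state_ge0.
- by rewrite (ushom1 fH) state1.
Qed.

Section CloseOn.
Variables (R : realType) (A : cstarAlgType R).
Implicit Types (phi : A -> R[i]) (ys zs : seq A).

(** The basic weak-star neighbourhoods: finitely many test elements and one radius. *)
Definition close_on ys (d : R) phi phi' :=
  forall y, y \in ys -> normc (phi y - phi' y) < d.

Lemma close_on_cat ys zs d d' phi phi' : close_on (ys ++ zs) (Num.min d d') phi phi' ->
  close_on ys d phi phi' /\ close_on zs d' phi phi'.
Proof.
by move=> h; split=> y yin; have := h y; rewrite mem_cat yin ?orbT lt_min => /(_ isT) /andP[].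
Qed.

End CloseOn.

Section Convolution.
Variables (R : realType) (G : compactQuantumGroup R).
Implicit Types phi psi chi : G -> R[i].

Definition conv phi psi : G -> R[i] := tstate (@tens R G) phi psi \o @comult R G.

Lemma conv_state phi psi : state phi -> state psi -> state (conv phi psi).
Proof.
move=> phiS psiS; apply: state_comp; first exact: comult_hom.
by have [] := tstateP (tens_spatial G) phiS psiS.
Qed.

(** The triple product states formed with either bracketing coincide on [cqg3]. Composed with Phi
    (x) id and id (x) Phi they become the product states of the two sides, and coassociativity
    identifies these on the image of Phi. *)
Lemma conv_assoc phi psi chi : state phi -> state psi -> state chi ->
  conv (conv phi psi) chi = conv phi (conv psi chi).
Proof.
move=> phiS psiS chiS.
have [F12S F12E] := tstateP (tens_spatial G) phiS psiS.
have [F23S F23E] := tstateP (tens_spatial G) psiS chiS.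
have [FlS FlE] := tstateP (tens21_spatial G) F12S chiS.
have [FrS FrE] := tstateP (tens12_spatial G) phiS F23S.
set F12 := tstate _ phi psi in F12S F12E FlS FlE; set F23 := tstate _ psi chi in F23S F23E FrS FrE.
set Fl := tstate _ F12 chi in FlS FlE; set Fr := tstate _ phi F23 in FrS FrE.
have lin c : scalar (fun x => Fr (tens21 x c)).
  by move=> k x y; rewrite (tens_linearl (tens21_spatial G)) stateL.
have FlFr : Fl = Fr.
  apply/funext/(state_tens_ext (tens21_spatial G)) => // x c; rewrite FlE.
  (* For fixed [c] the two functionals of [x] need not be states, so a common modulus of continuity
     is given by hand before comparing them on elementary tensors. *)
  have key : (fun x => F12 x * chi c) =1 (fun x => Fr (tens21 x c)); last exact: key.
  apply: (tens_ext (tens_spatial G)) => //=.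
  - by move=> k y z; rewrite stateL // mulrDl mulrA.
  - move=> {x}x e e0; pose N := normc (chi c) + nrm (tens21 1 c : cqg3 G) + 1.
    have N0 : 0 < N by rewrite ltr_wpDl // addr_ge0 ?normc_ge0 ?nrm_ge0.
    exists (e / N) => [|y]; first exact: divr_gt0.
    rewrite ltr_pdivlMr // => xy; split.
      rewrite -mulrBl -stateB // normc_mul; apply: le_lt_trans xy.
      apply: ler_pM; rewrite ?normc_ge0 ?state_le //.
      by rewrite /N -addrA lerDl addr_ge0 ?nrm_ge0.
    rewrite -stateB //; apply: le_lt_trans xy; apply: le_trans (state_le FrS _) _.
    have -> : tens21 x c - tens21 y c = tens21 (x - y) c :> cqg3 G.
      have := tens_linearl (tens21_spatial G) c (-1) y x.
      by rewrite !scaleN1r addrC => <-; rewrite addrC.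
    apply: le_trans (tens_nrml_le (tens21_spatial G) _ _) _.
    apply: ler_wpM2l; first exact: nrm_ge0.
    by rewrite /N addrAC lerDr addr_ge0 ?normc_ge0.
  - by move=> a b; rewrite F12E tens_assoc FrE F23E mulrA.
have [f [g [[fH fE] [gH gE] fg]]] := comult_coassoc G.
have cS := conv_state phiS psiS; have cS' := conv_state psiS chiS.
have l : Fl \o f = tstate (@tens R G) (conv phi psi) chi.
  apply: (tstate_unique (tens_spatial G)) => //; first exact: state_comp.
  by move=> a b /=; rewrite fE FlE.
have r : Fr \o g = tstate (@tens R G) phi (conv psi chi).
  apply: (tstate_unique (tens_spatial G)) => //; first exact: state_comp.
  by move=> a b /=; rewrite gE FrE.
by apply/funext => a; rewrite /conv /= -l -r /= FlFr fg.
Qed.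

Lemma comult_linear : linear (@comult R G).
Proof. exact: (ushom_linear (comult_hom G)). Qed.

Lemma slice_tstate phi (F : cqg2 G -> R[i]) (s : cqg2 G -> G) :
  state phi -> linear s -> continuous s -> state F ->
  (forall a b, phi (s (tens a b)) = F (tens a b)) -> phi \o s =1 F.
Proof.
move=> phiS sl sc FS E; apply: (tens_ext (tens_spatial G)) => //=.
- by move=> c x y /=; rewrite sl stateL.
- by case: FS.
- move=> x e e0; have [d d0 hd] := continuous_nrm sc x e0.
  exists (Num.min d e) => [|y]; first by rewrite lt_min d0 e0.
  rewrite lt_min => /andP[xd xe]; split; rewrite -stateB //.
    by apply: le_lt_trans (hd _ xd); exact: state_le.
  by apply: le_lt_trans xe; exact: state_le.
Qed.

(** The default case of [xget] is carried along as the zero map, for which the invariance inequality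
    is immediate. *)
Lemma convlP psi : state psi -> convl psi = (fun=> 0) \/
  [/\ linear (convl psi), convl psi 1 = 1 &
      forall phi, state phi -> forall a, phi (convl psi a) = conv phi psi a].
Proof.
move=> psiS; rewrite /convl /slicer; case: xgetP => [s _ [sl sc sE]|_]; last by left.
right; split=> [c x y||phi phiS a].
- by rewrite comult_linear sl.
- by rewrite (ushom1 (comult_hom G)) -(tens1 (tens_spatial G)) sE state1 // scale1r.
- have [FS FE] := tstateP (tens_spatial G) phiS psiS.
  apply: (@slice_tstate phi _ s phiS sl sc FS) => b c.
  by rewrite sE stateZ // FE mulrC.
Qed.

Lemma convrP psi : state psi -> (fun a => convr a psi) = (fun=> 0) \/
  [/\ linear (fun a => convr a psi), convr 1 psi = 1 &
      forall phi, state phi -> forall a, phi (convr a psi) = conv psi phi a].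
Proof.
move=> psiS; rewrite /convr /slicel; case: xgetP => [s _ [sl sc sE]|_]; last by left.
right; split=> [c x y||phi phiS a].
- by rewrite comult_linear sl.
- by rewrite (ushom1 (comult_hom G)) -(tens1 (tens_spatial G)) sE state1 // scale1r.
- have [FS FE] := tstateP (tens_spatial G) psiS phiS.
  apply: (@slice_tstate phi _ s phiS sl sc FS) => b c.
  by rewrite sE stateZ // FE.
Qed.

(** Phi(a) is within e/3 of a finite tensor sum, on which the varying state enters only through
    finitely many values, multiplied by values of [chi] bounded by norms. The modulus is therefore
    uniform in [chi]. The maps [l] and [r] say which tensor factor carries the varying state. *)
Lemma conv_equi_gen (F : (G -> R[i]) -> (G -> R[i]) -> G -> R[i])
    (l r : G * G -> G) a (e : R) :
  (forall phi chi, state phi -> state chi -> exists2 S : cqg2 G -> R[i], state S &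
     F phi chi a = S (comult a) /\
     forall p, S (tens p.1 p.2) = phi (l p) * chi (r p)) ->
  0 < e -> exists ys, exists2 d : R, 0 < d & forall phi phi' chi,
    state phi -> state phi' -> state chi -> close_on ys d phi phi' ->
    normc (F phi chi a - F phi' chi a) < e.
Proof.
move=> FP e0; have e3 : 0 < e / 3 by rewrite divr_gt0.
have [s hs] := tsum_dense (tens_spatial G) (comult a) e3.
pose N := \sum_(p <- s) nrm (r p) + 1.
have N0 : 0 < N by rewrite ltr_wpDl // sumr_ge0 // => p _; exact: nrm_ge0.
exists [seq l p | p <- s], (e / 3 / N) => [|phi phi' chi phiS phiS' chiS cl]; first exact: divr_gt0.
have [S SS [-> SE]] := FP _ _ phiS chiS; have [S' SS' [-> SE']] := FP _ _ phiS' chiS.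
have h1 : normc (S (comult a) - S (tsum (@tens R G) s)) < e / 3.
  by rewrite -stateB //; apply: le_lt_trans hs; exact: state_le.
have h2 : normc (S' (tsum (@tens R G) s) - S' (comult a)) < e / 3.
  by rewrite -stateB //; apply: le_lt_trans hs; rewrite nrmBC; exact: state_le.
have h3 : normc (S (tsum (@tens R G) s) - S' (tsum (@tens R G) s)) <= e / 3.
  have -> : S (tsum (@tens R G) s) - S' (tsum (@tens R G) s) =
      \sum_(p <- s) (phi (l p) - phi' (l p)) * chi (r p).
    rewrite /tsum !state_sum // -sumrB; apply: eq_bigr => p _.
    by rewrite SE SE' mulrBl.
  apply: le_trans (normc_sum _ _ _) _.
  apply: (@le_trans _ _ (\sum_(p <- s) e / 3 / N * nrm (r p))).
    rewrite big_seq [leRHS]big_seq; apply: ler_sum => p ps; rewrite normc_mul.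
    apply: ler_pM; rewrite ?normc_ge0 ?state_le //.
    by apply/ltW/cl/map_f.
  rewrite -mulr_sumr -mulrA ger_pMr //.
  by rewrite mulrC ler_pdivrMr // mul1r lerDl.
have := normc_tri (S (tsum (@tens R G) s)) (S (comult a)) (S' (comult a)).
have := normc_tri (S' (tsum (@tens R G) s)) (S (tsum (@tens R G) s)) (S' (comult a)); lra.
Qed.

Lemma conv_equi_l a (e : R) : 0 < e -> exists ys, exists2 d : R, 0 < d & forall phi phi' chi,
  state phi -> state phi' -> state chi -> close_on ys d phi phi' ->
  normc (conv phi chi a - conv phi' chi a) < e.
Proof.
apply: (conv_equi_gen (F := conv) (l := fst) (r := snd)) => phi chi phiS chiS.
have [tS tE] := tstateP (tens_spatial G) phiS chiS.
by exists (tstate (@tens R G) phi chi) => //; split=> // -[b c]; rewrite tE.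
Qed.

Lemma conv_equi_r a (e : R) : 0 < e -> exists ys, exists2 d : R, 0 < d & forall phi phi' chi,
  state phi -> state phi' -> state chi -> close_on ys d phi phi' ->
  normc (conv chi phi a - conv chi phi' a) < e.
Proof.
apply: (conv_equi_gen (F := fun phi chi => conv chi phi) (l := snd) (r := fst)).
move=> phi chi phiS chiS; have [tS tE] := tstateP (tens_spatial G) chiS phiS.
by exists (tstate (@tens R G) chi phi) => //; split=> // -[b c]; rewrite tE mulrC.
Qed.

(* Convolution on either side by an optional state, None standing for no convolution. *)
Definition ostate (l : option (G -> R[i])) := if l is Some chi then state chi else True.
Definition oconvl l phi := if l is Some chi then conv chi phi else phi.
Definition oconvr r phi := if r is Some chi then conv phi chi else phi.
Definition oconv l r phi := oconvl l (oconvr r phi).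

Lemma oconvl_state l phi : ostate l -> state phi -> state (oconvl l phi).
Proof. by case: l => // chi; exact: conv_state. Qed.

Lemma oconvr_state r phi : ostate r -> state phi -> state (oconvr r phi).
Proof. by case: r => // chi ? ?; exact: conv_state. Qed.

Lemma oconv_state l r phi : ostate l -> ostate r -> state phi -> state (oconv l r phi).
Proof. by move=> ? ? ?; apply/oconvl_state/oconvr_state. Qed.

Lemma oconv_convr l r phi psi : ostate r -> state phi -> state psi ->
  oconv l r (conv phi psi) = oconv l (Some (oconvr r psi)) phi.
Proof. by case: r => [chi|] //= chiS phiS psiS; rewrite /oconv /= conv_assoc. Qed.

Lemma oconv_convl l r phi psi : ostate l -> ostate r -> state phi -> state psi ->
  oconv l r (conv psi phi) = oconv (Some (oconvl l psi)) r phi.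
Proof.
move=> lS rS phiS psiS.
have E : oconvr r (conv psi phi) = conv psi (oconvr r phi).
  by case: r rS => //= chi chiS; rewrite conv_assoc.
by rewrite /oconv E; case: l lS => //= chi chiS; rewrite conv_assoc //; exact: oconvr_state.
Qed.

(** The two one-sided estimates are chained. The outer convolution asks for closeness of the inner
    one on finitely many elements, which is available uniformly in the right-hand state; the modulus
    is thus uniform over the whole orbit. *)
Lemma oconv_equi a (e : R) : 0 < e -> exists ys, exists2 d : R, 0 < d & forall l r phi phi',
  ostate l -> ostate r -> state phi -> state phi' -> close_on ys d phi phi' ->
  normc (oconv l r phi a - oconv l r phi' a) < e.
Proof.
have equir b (c : R) : 0 < c -> exists ys, exists2 d : R, 0 < d & forall r phi phi',
    ostate r -> state phi -> state phi' -> close_on ys d phi phi' ->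
    normc (oconvr r phi b - oconvr r phi' b) < c.
  move=> c0; have [ys [d d0 hd]] := conv_equi_l b c0.
  (* The extra element [b] with radius [c] settles the case [None], where no convolution takes
     place. *)
  exists (ys ++ [:: b]), (Num.min d c) => [|r phi phi' rS phiS phiS' /close_on_cat[h1 h2]].
    by rewrite lt_min d0.
  by case: r rS => [chi|] rS; [exact: hd|apply: h2; rewrite mem_head].
have equirs (zs : seq G) (c : R) : 0 < c -> exists ys, exists2 d : R, 0 < d & forall r phi phi',
    ostate r -> state phi -> state phi' -> close_on ys d phi phi' ->
    close_on zs c (oconvr r phi) (oconvr r phi').
  move=> c0; elim: zs => [|z zs [ys [d d0 hd]]]; first by exists [::], 1.
  have [ys' [d' d'0 hd']] := equir z _ c0.
  exists (ys' ++ ys), (Num.min d' d) => [|r phi phi' rS phiS phiS' /close_on_cat[h1 h2]].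
    by rewrite lt_min d0 d'0.
  by move=> y; rewrite inE => /orP[/eqP ->|]; [exact: hd'|exact: hd].
move=> e0; have [zs [c c0 hc]] := conv_equi_r a e0.
have ce0 : 0 < Num.min c e by rewrite lt_min c0.
have [ys [d d0 hd]] := equirs (zs ++ [:: a]) _ ce0.
exists ys, d => // l r phi phi' lS rS phiS phiS' /(hd r _ _ rS phiS phiS') /close_on_cat[h1 h2].
case: l lS => [chi|] lS; last by apply: h2; rewrite mem_head.
by apply: hc => //; exact: oconvr_state.
Qed.

End Convolution.

(** * Gauge seminorms *)

Section Gauge.
Variables (R : realType) (B : cstarAlgType R) (X : set B).
Implicit Types (a b : B) (r : R).

(** The cost of writing [b] as a scalar plus a finite combination of generators. The infimum of the
    costs is the gauge of the absolutely convex hull of [X] together with the scalars; it is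
    infinite off their span, as the infimum of the empty set. *)
Definition gauge_repr b r := exists (s : seq (R[i] * B)) (c0 : R[i]),
  [/\ forall p, p \in s -> X p.2, b = c0 *: 1 + \sum_(p <- s) p.1 *: p.2 &
      r = \sum_(p <- s) normc p.1].

Definition gauge b : \bar R := ereal_inf [set r%:E | r in gauge_repr b].

Lemma gauge_repr_ge0 b r : gauge_repr b r -> 0 <= r.
Proof. by move=> [s [c0 [_ _ ->]]]; apply: sumr_ge0 => p _; exact: normc_ge0. Qed.

Lemma gauge_reprD a b r t : gauge_repr a r -> gauge_repr b t -> gauge_repr (a + b) (r + t).
Proof.
move=> [s [c [hs -> ->]]] [s' [c' [hs' -> ->]]]; exists (s ++ s'), (c + c'); split.
- by move=> p; rewrite mem_cat => /orP[]; [exact: hs|exact: hs'].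
- by rewrite big_cat scalerDl addrACA.
- by rewrite big_cat.
Qed.

Lemma gauge_reprZ c b r : gauge_repr b r -> gauge_repr (c *: b) (normc c * r).
Proof.
move=> [s [c0 [hs -> ->]]]; exists [seq (c * p.1, p.2) | p <- s], (c * c0); split.
- by move=> _ /mapP[p /hs ? ->].
- rewrite big_map scalerDr scalerA scaler_sumr; congr (_ + _).
  by apply: eq_bigr => p _; rewrite scalerA.
- by rewrite big_map mulr_sumr; apply: eq_bigr => p _; rewrite normc_mul.
Qed.

Lemma gauge_repr_morph (f : B -> B) b r : linear f -> f 1 = 1 -> (forall x, X x -> X (f x)) ->
  gauge_repr b r -> gauge_repr (f b) r.
Proof.
move=> fl f1 fX [s [c0 [hs -> ->]]].
exists [seq (p.1, f p.2) | p <- s], c0; split.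
- by move=> _ /mapP[p /hs ? ->]; exact: fX.
- rewrite fl f1 (big_morph f (linear_mapD fl) (linear_map0 fl)) big_map; congr (_ + _).
  by apply: eq_bigr => p _; rewrite linear_mapZ.
- by rewrite big_map.
Qed.

Lemma gauge_le b r : gauge_repr b r -> (gauge b <= r%:E)%E.
Proof. by move=> h; apply: ereal_inf_lbound; exists r. Qed.

Lemma gauge_lt b (x : \bar R) : (gauge b < x)%E -> exists2 r, gauge_repr b r & (r%:E < x)%E.
Proof. by move=> /ereal_inf_lt[_ [r hr <-] h]; exists r. Qed.

Lemma gauge_ge0 b : (0 <= gauge b)%E.
Proof. by apply/ereal_infP => _ [r /gauge_repr_ge0 r0 <-]; rewrite lee_fin. Qed.

Lemma gauge_morph_le (f : B -> B) b : linear f -> f 1 = 1 -> (forall x, X x -> X (f x)) ->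
  (gauge (f b) <= gauge b)%E.
Proof.
by move=> fl f1 fX; apply/ereal_infP => _ [r hr <-]; apply/gauge_le/gauge_repr_morph.
Qed.

Lemma gauge1 (c : R[i]) : gauge (c *: 1) = 0%E.
Proof.
apply/eqP; rewrite eq_le gauge_ge0 andbT; apply: gauge_le.
by exists [::], c; rewrite !big_nil addr0.
Qed.

Lemma gauge0 : gauge 0 = 0%E.
Proof. by rewrite -(gauge1 0) scale0r. Qed.

Lemma gaugeZ (c : R[i]) b : gauge (c *: b) = ((normc c)%:E * gauge b)%E.
Proof.
have [->|c0] := eqVneq c 0; first by rewrite scale0r normc0 mul0e gauge0.
have n0 : 0 < normc c.
  by rewrite lt_neqAle normc_ge0 andbT eq_sym; apply: contra c0 => /eqP/eq0_normc ->.
rewrite /gauge -ereal_inf_pZl //.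
congr ereal_inf; apply/seteqP; split=> [_ [r hr <-]|_ [_ [r hr <-] <-]].
- exists (r / normc c)%:E.
    exists (r / normc c) => //; rewrite -[b](scalerK c0) mulrC -normcV.
    exact: gauge_reprZ.
  by rewrite -EFinM mulrCA mulfV ?mulr1 // gt_eqF.
- by exists (normc c * r) => //; exact: gauge_reprZ.
Qed.

Lemma gaugeD a b : (gauge (a + b)%R <= gauge a + gauge b)%E.
Proof.
have [->|ha] := eqVneq (gauge a) +oo%E.
  by rewrite addye ?leey // gt_eqF // (lt_le_trans _ (gauge_ge0 b)) // ltNyr.
have [->|hb] := eqVneq (gauge b) +oo%E.
  by rewrite addey ?leey // gt_eqF // (lt_le_trans _ (gauge_ge0 a)) // ltNyr.
have fa : gauge a \is a fin_num by rewrite ge0_fin_numE ?gauge_ge0 // ltey.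
have fb : gauge b \is a fin_num by rewrite ge0_fin_numE ?gauge_ge0 // ltey.
apply/lee_addgt0Pr => e e0; have e2 : 0 < e / 2 by rewrite divr_gt0.
have [r hr ra] : exists2 r, gauge_repr a r & (r%:E < gauge a + (e / 2)%:E)%E.
  by apply: gauge_lt; rewrite lteDl // lte_fin.
have [t ht tb] : exists2 r, gauge_repr b r & (r%:E < gauge b + (e / 2)%:E)%E.
  by apply: gauge_lt; rewrite lteDl // lte_fin.
apply: le_trans (gauge_le (gauge_reprD hr ht)) _.
rewrite [e]splitr !EFinD addeACA; apply: leeD; exact: ltW.
Qed.

Lemma gauge_seminorm : ext_seminorm gauge.
Proof. by split; [exact: gauge_ge0|exact: gaugeZ|exact: gaugeD]. Qed.

Lemma gauge_star b : (forall x, X x -> X (star x)) -> gauge b = gauge (star b).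
Proof.
move=> Xs.
have le a : (gauge (star a) <= gauge a)%E.
  apply/ereal_infP => _ [r [s [c0 [hs -> ->]]] <-]; apply: gauge_le.
  exists [seq (Num.conj p.1, star p.2) | p <- s], (Num.conj c0); split.
  - by move=> _ /mapP[p /hs ? ->]; exact: Xs.
  - rewrite starD starZ star1 star_sum big_map; congr (_ + _).
    by apply: eq_bigr => p _; rewrite starZ.
  - rewrite big_map; apply: eq_bigr => p _ /=.
    by case: p.1 => x y /=; rewrite sqrrN.
by apply/eqP; rewrite eq_le le -{1}(starK b) le.
Qed.

Lemma gauge_fin_gen x : X x -> (gauge x < +oo)%E.
Proof.
move=> Xx; apply: le_lt_trans (gauge_le _) (ltry 1); exists [:: (1, x)], 0; split.
- by move=> p; rewrite inE => /eqP ->.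
- by rewrite big_seq1 scale0r add0r scale1r.
- by rewrite big_seq1 normc1.
Qed.

Lemma gauge_finZ c x : (gauge x < +oo)%E -> (gauge (c *: x) < +oo)%E.
Proof.
move=> h; have fx : gauge x \is a fin_num by rewrite ge0_fin_numE ?gauge_ge0.
by rewrite gaugeZ -(fineK fx) -EFinM ltry.
Qed.

Lemma gauge_fin_sum I (r : seq I) (P : pred I) (F : I -> B) :
  (forall i, P i -> (gauge (F i) < +oo)%E) -> (gauge (\sum_(i <- r | P i) F i)%R < +oo)%E.
Proof.
move=> h; apply: (big_ind (fun v => (gauge v < +oo)%E)) => //.
  by rewrite gauge0.
by move=> x y hx hy; apply: le_lt_trans (gaugeD x y) _; rewrite lte_add_pinfty.
Qed.

(** Two states agree on the scalar part, so a representation of cost r bounds the difference by r M;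
    gauge at most 1 supplies costs below 1 + e. *)
Lemma gauge_state_dist phi psi (M : R) : 0 <= M -> state phi -> state psi ->
  (forall x, X x -> normc (phi x - psi x) <= M) -> (state_dist gauge phi psi <= M%:E)%E.
Proof.
move=> M0 phiS psiS hM; apply: ge_ereal_sup => _ [b /= b1 <-]; rewrite lee_fin.
have hr r : gauge_repr b r -> normc (phi b - psi b) <= r * M.
  move=> [s [c0 [hs -> ->]]].
  rewrite !stateD // !stateZ // !state1 // opprD addrACA subrr add0r.
  rewrite !state_sum // -sumrB mulr_suml (le_trans (normc_sum _ _ _)) //.
  rewrite big_seq [leRHS]big_seq; apply: ler_sum => p /hs Xp.
  rewrite !stateZ // -mulrBr normc_mul; apply: ler_wpM2l; first exact: normc_ge0.
  exact: hM.
rewrite -subr_le0; apply: (@le0_eps _ _ M) => e e0.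
have [r hbr r1] : exists2 r, gauge_repr b r & (r%:E < (1 + e)%:E)%E.
  by apply: gauge_lt; apply: le_lt_trans b1 _; rewrite lte_fin; lra.
have := hr _ hbr; rewrite lte_fin in r1; nra.
Qed.

End Gauge.

(** * The weak-star topology on the state space *)

Lemma ball_normc (R : realType) (z w : R[i]^o) (d : R) :
  ball z d%:C w = (normc (z - w) < d) :> Prop.
Proof. by rewrite -ball_normE /= ltcR. Qed.

Lemma ptws_eval_nbhs (U : eqType) (V : topologicalType) (f : {ptws U -> V}) (y : U) (O : set V) :
  nbhs (f y) O -> nbhs f [set g : {ptws U -> V} | O (g y)].
Proof. by move=> fyO; exact: (@proj_continuous U (fun=> V) y f O fyO). Qed.

Section WeakStar.
Variables (R : realType) (B : cstarAlgType R).
Implicit Types phi psi : B -> R[i].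

Lemma ptws_close_on (phi : {ptws B -> R[i]^o}) (ys : seq B) (d : R) : 0 < d ->
  nbhs phi (close_on ys d phi).
Proof.
move=> d0; elim: ys => [|y ys ih].
  by apply: (@filterS _ _ (nbhs_filter phi) _ _ _ filterT) => psi _ y; rewrite in_nil.
have d0' : (0 : R[i]) < d%:C by rewrite ltcR.
have hy := @ptws_eval_nbhs B (R[i]^o) phi y _ (nbhsx_ballx (phi y : R[i]^o) _ d0').
apply: (@filterS _ _ (nbhs_filter phi) _ _ _ 
  (@filterI _ _ (nbhs_filter phi) _ _ hy ih)) => psi [h1 h2] z.
rewrite inE => /orP[/eqP ->|]; first by rewrite -ball_normc.
exact: h2.
Qed.

(** The sets containing a basic neighbourhood form a filter that converges pointwise to [phi], so it
    contains every neighbourhood. *)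
Lemma ptws_close_onP (phi : {ptws B -> R[i]^o}) (W : set {ptws B -> R[i]^o}) :
  nbhs phi W -> exists ys, exists2 d : R, 0 < d & forall psi, close_on ys d phi psi -> W psi.
Proof.
pose F : set_system (B -> R[i]^o) := [set W | exists ys, exists2 d : R, 0 < d &
  forall psi, close_on ys d phi psi -> W psi].
have FF : Filter F.
  split.
  - by exists [::], 1.
  - move=> P Q [ys [d d0 hP]] [zs [c c0 hQ]].
    exists (ys ++ zs), (Num.min d c) => [|psi /close_on_cat[h1 h2]].
      by rewrite lt_min d0.
    by split; [exact: hP|exact: hQ].
  - by move=> P Q PQ [ys [d d0 hP]]; exists ys, d => // psi /hP /PQ.
have cF : {ptws, F --> (phi : B -> R[i]^o)}.
  apply/pointwise_cvgP => t V /nbhs_ballP[e /= e0 eV].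
  have eE : e = (complex.Re e)%:C by apply/esym/RRe_real/gtr0_real.
  exists [:: t], (complex.Re e) => [|psi h]; first by rewrite -ltcR -eE.
  apply: eV; have := h t (mem_head _ _).
  by rewrite eE ball_normc.
by move=> /cF.
Qed.

Variable L : B -> \bar R.
Hypothesis Ls : ext_seminorm L.

Lemma state_dist_lt phi psi (r : R) a (l : R) : state phi -> state psi -> 0 < l ->
  (L a <= l%:E)%E -> (state_dist L phi psi < r%:E)%E -> normc (phi a - psi a) < r * l.
Proof.
move=> phiS psiS l0 La hr; pose b := (l^-1)%:C *: a.
have Lb : (L b <= 1)%E.
  case: Ls => _ LZ _; rewrite /b LZ normc_real gtr0_norm ?invr_gt0 // lee_pdivrMl //.
  by rewrite mule1.
have : ((normc (phi b - psi b))%:E <= state_dist L phi psi)%E.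
  by apply: ereal_sup_ubound; exists b.
move=> /le_lt_trans/(_ hr); rewrite lte_fin /b !stateZ // -mulrBr normc_mul normc_real.
by rewrite gtr0_norm ?invr_gt0 // mulrC ltr_pdivrMr.
Qed.

(** The first condition bounds the metric on weak-star neighbourhoods, uniformly in [phi]. By the
    second, [L] is finite on a dense set; metric closeness controls the values there, and states are
    contractive, so it controls them everywhere. *)
Lemma weak_star_criterion :
  (forall (r : R), 0 < r -> exists ys, exists2 d : R, 0 < d & forall phi psi, state phi ->
     state psi -> close_on ys d phi psi -> (state_dist L phi psi <= r%:E)%E) ->
  (forall b (e : R), 0 < e -> exists2 a, (L a < +oo)%E & nrm (b - a) < e) ->
  induces_weak_star L.
Proof.
move=> H1 H2 phi phiS U; split=> [/ptws_close_onP[ys [d d0 hU]]|[r r0 hU]].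
- suff [r r0 hr] : exists2 r : R, 0 < r & forall psi, state psi ->
      (state_dist L phi psi < r%:E)%E -> close_on ys d phi psi.
    by exists r => // psi psiS /hr h; apply: (hU psi) => //; exact: h.
  elim: ys {hU} => [|y ys [r r0 hr]]; first by exists 1.
  have d3 : 0 < d / 3 by rewrite divr_gt0.
  have [a La hya] := H2 y _ d3.
  have L0 : (0 <= L a)%E by case: Ls.
  have fL : L a \is a fin_num by rewrite ge0_fin_numE.
  (* Adding 1 makes [l] positive even when [L a] is 0. *)
  pose l := fine (L a) + 1.
  have l0 : 0 < l by rewrite ltr_wpDl // fine_ge0.
  exists (Num.min r (d / 3 / l)) => [|psi psiS]; first by rewrite lt_min r0 divr_gt0.
  rewrite EFin_min lt_min => /andP[/(hr _ psiS) h1 h2].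
  move=> z; rewrite inE => /orP[/eqP ->|]; last exact: h1.
  have La' : (L a <= l%:E)%E by rewrite -(fineK fL) lee_fin lerDl.
  have := state_dist_lt phiS psiS l0 La' h2; rewrite divfK ?gt_eqF // => h3.
  have h4 : normc (phi y - phi a) <= nrm (y - a) by rewrite -stateB // state_le.
  have h5 : normc (psi a - psi y) <= nrm (y - a) by rewrite nrmBC -stateB // state_le.
  have := normc_tri (phi a) (phi y) (psi y); have := normc_tri (psi a) (phi a) (psi y); lra.
- have r2 : 0 < r / 2 by rewrite divr_gt0.
  have [ys [d d0 hd]] := H1 _ r2.
  apply: (@filterS _ _ (nbhs_filter phi) _ _ _ (ptws_close_on phi ys d0)).
  move=> psi cl psiS; apply: hU => //.
  apply: le_lt_trans (hd _ _ phiS psiS cl) _.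
  by rewrite lte_fin; lra.
Qed.

End WeakStar.

(** * The gauge of the weighted orbits *)

Section OrbitGauge.
Variables (R : realType) (G : compactQuantumGroup R) (a : nat -> G).

(** The factor 1 + |a_n| normalizes, and n + 1 makes the weights decay: states are at most 1/(n + 1)
    in modulus on the generators coming from a_n. *)
Definition orbit_weight n : R := (n.+1%:R * (1 + nrm (a n)))^-1.

(* The translates of a_n (and of its adjoint) are described by the values that
   states take on them; a translate of an element by a state is one whenever the
   slice map exists, and is 0 otherwise. *)
Definition orbit_gens : set G := [set x | exists n b y l r,
  [/\ b = a n \/ b = star (a n), ostate l, ostate r,
      forall phi, state phi -> phi y = oconv l r phi b & x = (orbit_weight n)%:C *: y]].

Lemma orbit_weight_gt0 n : 0 < orbit_weight n.
Proof. by rewrite invr_gt0 mulr_gt0 // ltr_pwDl // nrm_ge0. Qed.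

Lemma orbit_gens_mem n : orbit_gens ((orbit_weight n)%:C *: a n).
Proof. by exists n, (a n), (a n), None, None; split=> //; left. Qed.

Lemma orbit_gens_star x : orbit_gens x -> orbit_gens (star x).
Proof.
move=> [n [b [y [l [r [hb lS rS hy ->]]]]]]; exists n, (star b), (star y), l, r; split=> //.
- by case: hb => ->; [right|left; rewrite starK].
- move=> phi phiS; rewrite state_star // hy // state_star //; exact: oconv_state.
- by rewrite starZr.
Qed.

(** By associativity, the new convolution by [psi] is absorbed into the right-hand state of the
    translate. *)
Lemma orbit_gens_convr (f : G -> G) psi : linear f -> state psi ->
  (forall phi, state phi -> forall x, phi (f x) = conv phi psi x) ->
  forall x, orbit_gens x -> orbit_gens (f x).
Proof.
move=> fl psiS hf x [n [b [y [l [r [hb lS rS hy ->]]]]]].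
exists n, b, (f y), l, (Some (oconvr r psi)); split=> //; first exact: oconvr_state.
- move=> phi phiS; rewrite hf // hy; last exact: conv_state.
  by rewrite oconv_convr.
- exact: linear_mapZ.
Qed.

Lemma orbit_gens_convl (f : G -> G) psi : linear f -> state psi ->
  (forall phi, state phi -> forall x, phi (f x) = conv psi phi x) ->
  forall x, orbit_gens x -> orbit_gens (f x).
Proof.
move=> fl psiS hf x [n [b [y [l [r [hb lS rS hy ->]]]]]].
exists n, b, (f y), (Some (oconvl l psi)), r; split=> //; first exact: oconvl_state.
- move=> phi phiS; rewrite hf // hy; last exact: conv_state.
  by rewrite oconv_convl.
- exact: linear_mapZ.
Qed.

(** This is the dual form of total boundedness of the generators, and supplies the first condition
    of [weak_star_criterion]. *)
Lemma orbit_gens_equi (r : R) : 0 < r -> exists ys, exists2 d : R, 0 < d &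
  forall phi psi, state phi -> state psi -> close_on ys d phi psi ->
  forall x, orbit_gens x -> normc (phi x - psi x) <= r.
Proof.
move=> r0.
have nb n b : b = a n \/ b = star (a n) -> nrm b = nrm (a n) by case=> ->; rewrite ?nrm_star.
have w1 n : orbit_weight n <= 1.
  rewrite invf_le1 ?mulr_gt0 // ?ltr_pwDl ?nrm_ge0 //.
  by rewrite mulr_ege1 ?ler1n // lerDl nrm_ge0.
(* Below N, equicontinuity of finitely many orbits; beyond, smallness of the weights. *)
have small N : exists ys, exists2 d : R, 0 < d & forall n b l r' phi psi, (n < N)%N ->
    b = a n \/ b = star (a n) -> ostate l -> ostate r' ->
    state phi -> state psi -> close_on ys d phi psi ->
    normc (oconv l r' phi b - oconv l r' psi b) <= r.
  elim: N => [|N [ys [d d0 hd]]]; first by exists [::], 1.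
  have [zs [c c0 hc]] := oconv_equi (a N) r0.
  have [zs' [c' c'0 hc']] := oconv_equi (star (a N)) r0.
  exists (ys ++ (zs ++ zs')), (Num.min d (Num.min c c')).
    by rewrite !lt_min d0 c0 c'0.
  move=> n b l r' phi psi; rewrite ltnS leq_eqVlt => + hb lS rS phiS psiS.
  move=> + /close_on_cat[h1 /close_on_cat[h2 h3]].
  case/orP => [/eqP nN|nN]; last exact: (hd n).
  by case: hb => ->; rewrite nN; apply/ltW; [exact: hc|exact: hc'].
have [N hN] : exists N : nat, 2 / r <= N.+1%:R.
  by exists (Num.truncn (2 / r)); apply/ltW; rewrite truncnS_gt // divr_ge0 // ltW.
have [ys [d d0 hd]] := small N; exists ys, d => // phi psi phiS psiS cl x.
move=> [n [b [y [l [r' [hb lS rS hy ->]]]]]].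
rewrite !stateZ // -mulrBr normc_mul normc_real gtr0_norm ?orbit_weight_gt0 // !hy //.
have [nN|Nn] := ltnP n N.
  have := hd n b l r' phi psi nN hb lS rS phiS psiS cl.
  have := w1 n; have := orbit_weight_gt0 n; have := normc_ge0 (oconv l r' phi b - oconv l r' psi b).
  by nra.
(* In the tail, two states differ by at most 2 |a_n| at [b], and the weight turns this into at most
   2/(n + 1), hence at most [r]. *)
have h : normc (oconv l r' phi b - oconv l r' psi b) <= 2 * nrm (a n).
  rewrite (le_trans (normc_add _ _)) // normc_opp -(nb n b hb).
  have := state_le (oconv_state lS rS phiS) b; have := state_le (oconv_state lS rS psiS) b; lra.
have a0 := nrm_ge0 (a n).
rewrite /orbit_weight mulrC ler_pdivrMr; last by rewrite mulr_gt0 // ltr_pwDl.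
apply: le_trans h _; rewrite mulrCA.
have h2 : 2 <= r * n.+1%:R.
  rewrite -ler_pdivrMl // mulrC; apply: le_trans hN _.
  by rewrite ler_nat ltnS.
nra.
Qed.

Definition orbit_gauge : G -> \bar R := gauge orbit_gens.

Lemma orbit_gauge_fin n : (orbit_gauge (a n) < +oo)%E.
Proof.
have w0 := orbit_weight_gt0 n.
have -> : a n = ((orbit_weight n)^-1)%:C *: ((orbit_weight n)%:C *: a n).
  by rewrite scalerA -rmorphM /= mulVf ?gt_eqF // scale1r.
by apply/gauge_finZ/gauge_fin_gen/orbit_gens_mem.
Qed.

Lemma orbit_gauge_lip_norm : (forall b (e : R), 0 < e -> exists n, nrm (b - a n) < e) ->
  lip_norm orbit_gauge.
Proof.
move=> ha; split; [exact: gauge_seminorm| |exact: gauge1|].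
- by move=> b; apply: gauge_star; exact: orbit_gens_star.
- apply: weak_star_criterion; first exact: gauge_seminorm.
    move=> r r0; have [ys [d d0 hd]] := orbit_gens_equi r0.
    exists ys, d => // phi psi phiS psiS cl.
    by apply: gauge_state_dist => //; [exact: ltW|exact: hd].
  by move=> b e /(ha b)[n hn]; exists (a n) => //; exact: orbit_gauge_fin.
Qed.

Lemma orbit_gauge_right_invariant : right_invariant orbit_gauge.
Proof.
move=> b _ psi psiS; case: (convlP psiS) => [->|[cl c1 cE]].
  by rewrite /orbit_gauge gauge0 gauge_ge0.
by apply: gauge_morph_le => //; exact: orbit_gens_convr cl psiS cE.
Qed.

Lemma orbit_gauge_left_invariant : left_invariant orbit_gauge.
Proof.
move=> b _ psi psiS; case: (convrP psiS) => [h|[cl c1 cE]].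
  by have -> : convr b psi = 0 := congr1 (fun f => f b) h; rewrite /orbit_gauge gauge0 gauge_ge0.
apply: (@gauge_morph_le _ _ _ (fun b => convr b psi)) => //.
exact: orbit_gens_convl cl psiS cE.
Qed.

End OrbitGauge.

(** * Intertwiners of neighbouring representations *)

Lemma archi_le0 (R : realType) (a K : R) : (forall k : nat, k%:R * a <= K) -> a <= 0.
Proof.
move=> h; rewrite leNgt; apply/negP => a0.
have K0 : 0 <= K by have := h 0%N; rewrite mul0r.
have := h (Num.truncn (K / a)).+1; apply/negP; rewrite -ltNge -ltr_pdivrMr //.
exact: truncnS_gt.
Qed.

Section MeanErgodic.
Variables (R : realType) (m : nat) (M : 'M[R[i]]_m).
Implicit Types x y t : 'rV[R[i]]_m.

Let orb k x := iter k (fun y => y *m M) x.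

(** If z = y (M - 1) is fixed by M, the orbit of y is y + k z, which is bounded only for z = 0. So
    kernel and range of M - 1 are complementary, and t = x + y (M - 1) with x fixed. The Cesaro
    means of the orbit of t differ from x by a telescoped term of order 1/k, whence x inherits every
    bound on the distance of that orbit from t. *)
Lemma mean_ergodic t : (forall x, exists K : R, forall k j, normc (orb k x 0 j) <= K) ->
  exists2 x, x *m M = x & forall j (d : R),
    (forall k, normc ((orb k t - t) 0 j) <= d) -> normc ((x - t) 0 j) <= d.
Proof.
move=> bdd; pose N := M - 1%:M.
have NE x : x *m N = x *m M - x by rewrite /N mulmxBr mulmx1.
have cap0 : (kermx N :&: N)%MS = 0.
  apply/eqP/rowV0P => z; rewrite sub_capmx => /andP[/sub_kermxP zN /submxP[y zy]].
  have zM : z *m M = z by apply/eqP; rewrite -subr_eq0 -NE zN.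
  have orbE k : orb k y = y + k%:R *: z.
    elim: k => [|k ih]; first by rewrite scale0r addr0.
    rewrite /orb iterS -/(orb k y) ih mulmxDl -scalemxAl zM.
    have -> : y *m M = y + z by rewrite zy NE addrC subrK.
    by rewrite -addrA -{1}(scale1r z) -scalerDl -natr1 [1 + _]addrC.
  have [K hK] := bdd y; apply/rowP => j; rewrite [RHS]mxE; apply: eq0_normc; apply/eqP.
  rewrite eq_le normc_ge0 andbT; apply: (@archi_le0 _ _ (K + normc (y 0 j))) => k.
  have := hK k j; rewrite orbE !mxE => h.
  have := normc_tri 0 (y 0 j + k%:R * z 0 j) (y 0 j).
  rewrite subr0 sub0r normc_opp [_ + _ - _]addrC addKr normc_mul.
  have -> : normc (k%:R : R[i]) = k%:R :> R.
    by rewrite -(rmorph_nat (real_complex R)) normc_real normr_nat.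
  lra.
have full : row_full (kermx N + N)%MS.
  by rewrite /row_full mxrank_disjoint_sum // mxrank_ker subnK ?rank_leq_row.
have /sub_addsmxP[[u y] /= tE] : (t <= kermx N + N)%MS by exact: submx_full.
pose x := u *m kermx N.
have xM : x *m M = x by apply/eqP; rewrite -subr_eq0 -NE -mulmxA mulmx_ker mulmx0.
exists x => // j d hd.
have orbt k : orb k t = x + (orb k.+1 y - orb k y).
  elim: k => [|k ih]; first by rewrite /orb /= tE NE.
  by rewrite /orb iterS -/(orb k t) ih mulmxDl mulmxBl xM.
have sumE k : \sum_(i < k) (orb i t - t) = k%:R *: (x - t) + (orb k y - y).
  elim: k => [|k ih]; first by rewrite big_ord0 scale0r subrr addr0.
  rewrite big_ord_recr ih /= orbt -natr1 scalerDl scale1r.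
  set a := k%:R *: _; set b := orb k y; set c := orb k.+1 y.
  have -> : x + (c - b) - t = (x - t) + (c - b) by rewrite addrAC.
  by rewrite addrACA; congr (_ + _); rewrite [b - y + _]addrC addrA subrK.
have [K hK] := bdd y.
rewrite -subr_le0; apply: (@archi_le0 _ _ (K + normc (y 0 j))) => k.
have h1 : normc ((\sum_(i < k) (orb i t - t)) 0 j) <= k%:R * d.
  rewrite summxE (le_trans (normc_sum _ _ _)) //.
  apply: (@le_trans _ _ (\sum_(i < k) d)); first exact: ler_sum.
  by rewrite sumr_const card_ord mulr_natl.
rewrite sumE 2!mxE in h1.
have h2 : normc ((orb k y - y) 0 j) <= K + normc (y 0 j).
  by rewrite !mxE (le_trans (normc_add _ _)) // normc_opp lerD2r.
have h3 : normc (k%:R * (x - t) 0 j) = k%:R * normc ((x - t) 0 j) :> R.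
  by rewrite normc_mul -(rmorph_nat (real_complex R)) normc_real normr_nat.
have := normc_tri (k%:R * (x - t) 0 j + (orb k y - y) 0 j) (k%:R * (x - t) 0 j) 0.
rewrite !subr0 h3 opprD addrA subrr add0r normc_opp mulrBr; lra.
Qed.

End MeanErgodic.

(** * States that are faithful on a finite-dimensional subspace *)

Section FaithfulState.
Variables (R : realType) (A : cstarAlgType R) (H : hilbertType R) (pi : A -> H -> H).
Hypotheses (piR : representation pi) (piI : injective pi).
Implicit Types (g : seq A) (x y : A).

(** The linear span of a list, peeling off one coefficient at a time to suit induction on the
    list. *)
Fixpoint in_span g x : Prop :=
  if g is y :: g' then exists c : R[i], in_span g' (x - c *: y) else x = 0.

Lemma in_spanZD g (c : R[i]) x y : in_span g x -> in_span g y -> in_span g (c *: x + y).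
Proof.
elim: g x y => [|z g ih] x y /=; first by move=> -> ->; rewrite scaler0 addr0.
move=> [a ha] [b hb]; exists (c * a + b).
have -> : c *: x + y - (c * a + b) *: z = c *: (x - a *: z) + (y - b *: z).
  by rewrite scalerBr scalerA scalerDl opprD addrACA.
exact: ih.
Qed.

Lemma in_span0 g : in_span g 0.
Proof. by elim: g => //= y g ih; exists 0; rewrite scale0r subr0. Qed.

Lemma in_spanZ g (c : R[i]) x : in_span g x -> in_span g (c *: x).
Proof. by move=> h; rewrite -(addr0 (c *: x)); apply: in_spanZD => //; exact: in_span0. Qed.

Lemma in_spanD g x y : in_span g x -> in_span g y -> in_span g (x + y).
Proof. by move=> hx hy; rewrite -(scale1r x); exact: in_spanZD. Qed.

Lemma in_spanB g x y : in_span g x -> in_span g y -> in_span g (x - y).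
Proof. by move=> hx hy; rewrite addrC -scaleN1r; exact: in_spanZD. Qed.

Lemma in_span_sum g I (r : seq I) (P : pred I) (F : I -> A) :
  (forall i, P i -> in_span g (F i)) -> in_span g (\sum_(i <- r | P i) F i).
Proof.
by move=> h; apply: big_ind => //; [exact: in_span0|move=> x y; exact: in_spanD].
Qed.

Lemma in_span_mem g y : y \in g -> in_span g y.
Proof.
elim: g => //= z g ih; rewrite inE => /orP[/eqP ->|yg].
  by exists 1; rewrite scale1r subrr; exact: in_span0.
by exists 0; rewrite scale0r subr0; exact: ih.
Qed.

(** When [y] joins the list, the vectors found so far fail only if they kill some nonzero h in y
    plus the old span. One more vector w not killed by h repairs this: an element x of the new span
    that is killed equals c h modulo the old span, so x = c h, and evaluation at w gives c = 0. *)
Lemma separating_vectors g : exists vs : seq H,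
  forall x, in_span g x -> (forall v, v \in vs -> pi x v = 0) -> x = 0.
Proof.
have piB x y v : pi (x - y) v = pi x v - pi y v by rewrite reprD // reprN.
elim: g => [|y g [vs hvs]]; first by exists [::].
have [[h [hy hvs0 h0]]|no] := pselect (exists h : A, [/\ in_span g (h - y),
    forall v, v \in vs -> pi h v = 0 & h != 0]).
  have [w hw] : exists w, pi h w != 0.
    apply: contrapT => no; move/eqP: h0; apply; apply: piI; apply/funext => w.
    by rewrite repr0 //; apply: contrapT => hw; apply: no; exists w; apply/eqP.
  exists (w :: vs) => x [c hc] kill.
  have e : x - c *: h = 0.
    apply: hvs.
      have -> : x - c *: h = (x - c *: y) - c *: (h - y).
        by rewrite scalerBr opprB addrA subrK.
      by apply: in_spanB => //; exact: in_spanZ.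
    move=> v vin; rewrite piB reprZ // hvs0 // scaler0 subr0 kill //.
    by rewrite inE vin orbT.
  have := kill w (mem_head _ _); rewrite (subr0_eq e) reprZ // => /eqP.
  rewrite scaler_eq0 (negPf hw) orbF => /eqP ->; rewrite scale0r //.
exists vs => x [c hc] kill.
have [c0|c0] := eqVneq c 0; first by apply: hvs => //; move: hc; rewrite c0 scale0r subr0.
apply: contrapT => /eqP x0; apply: no; exists (c^-1 *: x); split.
- rewrite -[y](scalerK c0) -scalerBr; exact: in_spanZ.
- by move=> v vin; rewrite reprZ // kill // scaler0.
- by rewrite scaler_eq0 negb_or invr_eq0 c0 x0.
Qed.

(** The state is the normalized sum of the vector functionals of separating vectors. Putting 1 into
    the list prevents all these vectors from being zero, so the normalizing constant [Z] is
    positive. *)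
Lemma faithful_state g : exists2 psi, state psi &
  forall x, in_span g x -> psi (star x * x) = 0 -> x = 0.
Proof.
have [vs hvs] := separating_vectors (1 :: g).
pose Z := \sum_(v <- vs) inner H v v.
have Z0 : 0 <= Z by apply: sumr_ge0 => v _; exact: inner_ge0.
have sum0 (F : H -> R[i]) : (forall v, 0 <= F v) -> \sum_(v <- vs) F v = 0 ->
    forall v, v \in vs -> F v = 0.
  move=> F0 /eqP; rewrite psumr_eq0 // => /allP h v /h /=.
  by move/eqP.
have Zn0 : Z != 0.
  apply/eqP => Ze; have /eqP := cone_neq0 (s := A); apply; apply: hvs.
    by apply: in_span_mem; rewrite mem_head.
  move=> v vin; rewrite (repr1 piR); apply: inner_eq0.
  by apply: (sum0 (fun v => inner H v v)) => // w; exact: inner_ge0.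
have Zp : 0 < Z by rewrite lt_neqAle eq_sym Zn0.
pose psi x := Z^-1 * \sum_(v <- vs) inner H (pi x v) v.
have sq x : psi (star x * x) = Z^-1 * \sum_(v <- vs) inner H (pi x v) (pi x v).
  by congr (_ * _); apply: eq_bigr => v _; rewrite repr_star_sq.
exists psi; first split.
- move=> c x y; rewrite /psi mulrCA -mulrDr; congr (_ * _).
  rewrite mulr_sumr -big_split; apply: eq_bigr => v _.
  by rewrite reprD // reprZ // innerDl innerZl.
- move=> x; rewrite sq; apply: mulr_ge0; first by rewrite invr_ge0.
  by apply: sumr_ge0 => v _; exact: inner_ge0.
- rewrite /psi (eq_bigr (fun v => inner H v v)) ?mulVf // => v _.
  by rewrite (repr1 piR).
move=> x xg /eqP; rewrite sq mulf_eq0 invr_eq0 (negPf Zn0) /= => /eqP s0.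
apply: hvs; first by exists 0; rewrite scale0r subr0.
move=> v vin; apply: inner_eq0; apply: (sum0 (fun v => inner H (pi x v) (pi x v))) => // w.
Qed.

End FaithfulState.

(** * Matrices over the algebra and their slices by states *)

Definition adjmx (R : realType) n (S : 'M[R[i]]_n) : 'M[R[i]]_n := (map_mx Num.conj S)^T.

Lemma adjmxK (R : realType) n : involutive (@adjmx R n).
Proof. by move=> S; apply/matrixP => i j; rewrite !mxE conjCK. Qed.

Lemma adjmxM (R : realType) n (S T : 'M[R[i]]_n) : adjmx (S *m T) = adjmx T *m adjmx S.
Proof. by rewrite /adjmx map_mxM trmx_mul. Qed.

(** A kernel vector satisfies x = - x (T - 1), so its l1 norm is at most n d times itself, with n d
    < 1. *)
Lemma unitmx_near1 (R : realType) n (T : 'M[R[i]]_n) (d : R) : n%:R * d < 1 ->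
  (forall i j, normc ((T - 1%:M) i j) <= d) -> T \in unitmx.
Proof.
move=> nd hT; rewrite unitmxE unitfE; apply/det0P => -[x x0 xT].
have xE : x = - (x *m (T - 1%:M)) by rewrite mulmxBr xT mulmx1 sub0r opprK.
pose s := \sum_j normc (x 0 j).
have s0 : 0 <= s by apply: sumr_ge0 => j _; exact: normc_ge0.
have hx j : normc (x 0 j) <= s * d.
  rewrite {1}xE !mxE normc_opp (le_trans (normc_sum _ _ _)) // /s mulr_suml.
  by apply: ler_sum => k _; rewrite normc_mul ler_wpM2l ?normc_ge0.
have : s <= n%:R * (s * d).
  rewrite {1}/s (@le_trans _ _ (\sum_(j < n) s * d)) //; first exact: ler_sum.
  by rewrite sumr_const card_ord mulr_natl.
rewrite mulrCA => h; have {h} s00 : s = 0.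
  apply/eqP; rewrite eq_le s0 andbT; move: h; set e := _ * d in nd *; nra.
move/eqP: x0; apply; apply/rowP => j; rewrite [RHS]mxE; apply: eq0_normc; apply/eqP.
by rewrite eq_le normc_ge0 andbT (le_trans (hx j)) // s00 mul0r.
Qed.

Section Intertwiners.
Variables (R : realType) (G : compactQuantumGroup R) (n : nat).
Implicit Types (X Y : 'M[G]_n) (S T : 'M[R[i]]_n).

Definition scmx S : 'M[G]_n := map_mx (in_alg G) S.

Lemma scmxM S T : scmx (S *m T) = scmx S *m scmx T.
Proof. exact: map_mxM. Qed.

Lemma scmx1 : scmx 1%:M = 1%:M.
Proof. by rewrite /scmx map_mx1. Qed.

Lemma scmx_mull S X i j : (scmx S *m X) i j = \sum_k S i k *: X k j.
Proof. by rewrite mxE; apply: eq_bigr => k _; rewrite mxE /= mulr_algl. Qed.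

Lemma scmx_mulr X S i j : (X *m scmx S) i j = \sum_k S k j *: X i k.
Proof. by rewrite mxE; apply: eq_bigr => k _; rewrite mxE /= mulr_algr. Qed.

Lemma mxstarM X Y : mxstar (X *m Y) = mxstar Y *m mxstar X.
Proof.
apply/matrixP => i j; rewrite !mxE star_sum; apply: eq_bigr => k _.
by rewrite !mxE starMr.
Qed.

Lemma mxstarK X : mxstar (mxstar X) = X.
Proof. by apply/matrixP => i j; rewrite !mxE starK. Qed.

Lemma mxstarB X Y : mxstar (X - Y) = mxstar X - mxstar Y.
Proof. by apply/matrixP => i j; rewrite !mxE starB. Qed.

Lemma mxstar_sc S : mxstar (scmx S) = scmx (adjmx S).
Proof. by apply/matrixP => i j; rewrite !mxE /= starZ star1. Qed.

Section State.
Variable psi : G -> R[i].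
Hypothesis psiS : state psi.

Lemma map_state_mull S X : map_mx psi (scmx S *m X) = S *m map_mx psi X.
Proof.
apply/matrixP => i j; rewrite mxE scmx_mull state_sum // mxE.
by apply: eq_bigr => k _; rewrite stateZ // mxE.
Qed.

Lemma map_state_mulr S X : map_mx psi (X *m scmx S) = map_mx psi X *m S.
Proof.
apply/matrixP => i j; rewrite mxE scmx_mulr state_sum // mxE.
by apply: eq_bigr => k _; rewrite stateZ // mxE mulrC.
Qed.

Lemma map_stateB X Y : map_mx psi (X - Y) = map_mx psi X - map_mx psi Y.
Proof. by apply/matrixP => i j; rewrite !mxE stateB. Qed.

Lemma map_state1 : map_mx psi (1%:M : 'M[G]_n) = 1%:M.
Proof.
by apply/matrixP => i j; rewrite !mxE; case: (i == j); rewrite ?state1 ?state0.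
Qed.

Lemma map_state_sc S : map_mx psi (scmx S) = S.
Proof. by rewrite -[scmx S]mulmx1 map_state_mull map_state1 mulmx1. Qed.

Lemma map_state_star X : map_mx psi (mxstar X) = adjmx (map_mx psi X).
Proof. by apply/matrixP => i j; rewrite !mxE state_star. Qed.

Lemma map_state_sq X j :
  (map_mx psi (mxstar X *m X)) j j = \sum_k psi (star (X k j) * X k j).
Proof. by rewrite !mxE state_sum //; apply: eq_bigr => k _; rewrite !mxE. Qed.

End State.

(** For unitary [v], the equation [twist v u T = scmx T] says that T u = v T, that is, T is an
    intertwiner. *)
Definition twist (v u : 'M[G]_n) T : 'M[G]_n := mxstar v *m scmx T *m u.

Lemma twistE v u T i j :
  twist v u T i j = \sum_l \sum_k T k l *: (star (v k i) * u l j).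
Proof.
rewrite /twist mxE; apply: eq_bigr => l _; rewrite scmx_mulr mulr_suml.
by apply: eq_bigr => k _; rewrite !mxE scalerAl.
Qed.

Definition twist_val (psi : G -> R[i]) v u T : 'M[R[i]]_n := map_mx psi (twist v u T).

Lemma twist_valE psi v u T i j : state psi ->
  twist_val psi v u T i j = \sum_l \sum_k T k l * psi (star (v k i) * u l j).
Proof.
move=> psiS; rewrite mxE twistE state_sum //; apply: eq_bigr => l _.
by rewrite state_sum //; apply: eq_bigr => k _; rewrite stateZ.
Qed.

Lemma twist_val_linear psi v u : state psi -> linear (twist_val psi v u).
Proof.
move=> psiS c S T; apply/matrixP => i j; 
have -> : (c *: twist_val psi v u S + twist_val psi v u T) i j =
    c * twist_val psi v u S i j + twist_val psi v u T i j by rewrite !mxE.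
rewrite !twist_valE //.
rewrite mulr_sumr -big_split; apply: eq_bigr => l _.
rewrite mulr_sumr -big_split; apply: eq_bigr => k _ /=.
by rewrite !mxE mulrDl mulrA.
Qed.

Lemma conv_coef (phi psi : G -> R[i]) (v u : 'M[G]_n) k i l j : state phi -> state psi ->
  unitary_rep v -> unitary_rep u -> conv phi psi (star (v k i) * u l j) =
  \sum_p \sum_q phi (star (v k p) * u l q) * psi (star (v p i) * u q j).
Proof.
move=> phiS psiS [_ _ vc] [_ _ uc].
have [tS tE] := tstateP (tens_spatial G) phiS psiS.
rewrite /conv /= (ushomM (comult_hom G)) (ushom_star (comult_hom G)) vc uc.
rewrite star_sum mulr_suml state_sum //; apply: eq_bigr => p _.
rewrite mulr_sumr state_sum //; apply: eq_bigr => q _.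
by rewrite (tens_star (tens_spatial G)) (tensM (tens_spatial G)) tE.
Qed.

(** Convolution of states becomes composition of maps. Hence every iterate of [twist_val psi v u] is
    again a slice by a state, which makes the map power bounded. *)
Lemma twist_val_conv phi psi v u T : state phi -> state psi ->
  unitary_rep v -> unitary_rep u ->
  twist_val (conv phi psi) v u T = twist_val psi v u (twist_val phi v u T).
Proof.
move=> phiS psiS vR uR; apply/matrixP => i j; rewrite !twist_valE //; last exact: conv_state.
pose F l k p q := T k l * (phi (star (v k p) * u l q) * psi (star (v p i) * u q j)).
transitivity (\sum_l \sum_k \sum_p \sum_q F l k p q).
  apply: eq_bigr => l _; apply: eq_bigr => k _; rewrite conv_coef // mulr_sumr.
  by apply: eq_bigr => p _; rewrite mulr_sumr.
transitivity (\sum_q \sum_p \sum_l \sum_k F l k p q).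
  rewrite pair_bigA /= (eq_bigr (fun lk => \sum_q \sum_p F lk.1 lk.2 p q)); last first.
    by move=> lk _; rewrite exchange_big.
  rewrite exchange_big; apply: eq_bigr => q _ /=.
  rewrite exchange_big; apply: eq_bigr => p _ /=.
  by rewrite pair_bigA.
apply: eq_bigr => q _; apply: eq_bigr => p _; rewrite twist_valE // mulr_suml.
apply: eq_bigr => l _; rewrite mulr_suml; apply: eq_bigr => k _.
by rewrite /F mulrA.
Qed.

Lemma twist_val_le phi v u T i j : state phi ->
  normc (twist_val phi v u T i j) <= nrm (twist v u T i j).
Proof. by move=> phiS; rewrite mxE state_le. Qed.

Lemma twist_val_iter psi v u k : state psi -> unitary_rep v -> unitary_rep u ->
  exists2 phi, state phi & forall T, iter k.+1 (twist_val psi v u) T = twist_val phi v u T.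
Proof.
move=> psiS vR uR; elim: k => [|k [phi phiS ih]]; first by exists psi.
exists (conv phi psi) => [|T]; first exact: conv_state.
by rewrite iterS ih twist_val_conv.
Qed.

(** [mean_ergodic] on matrices flattened to row vectors, started at 1. A bound valid for the slices
    by all states holds along the whole orbit; [0 <= d] covers its initial point. *)
Lemma twist_val_fixed psi v u : state psi -> unitary_rep v -> unitary_rep u ->
  exists2 T, twist_val psi v u T = T & forall i j (d : R), 0 <= d ->
    (forall phi, state phi -> normc ((twist_val phi v u 1%:M - 1%:M) i j) <= d) ->
    normc ((T - 1%:M) i j) <= d.
Proof.
move=> psiS vR uR; pose f := twist_val psi v u.
pose fL : {linear 'M[R[i]]_n -> 'M[R[i]]_n} :=
  HB.pack f (GRing.isLinear.Build _ _ _ _ f (twist_val_linear v u psiS)).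
pose M := lin_mx fL.
have orbE k T : iter k (fun y => y *m M) (mxvec T) = mxvec (iter k f T).
  by elim: k => //= k ->; rewrite mul_vec_lin.
have [|x xM hx] := @mean_ergodic _ _ M (mxvec 1%:M).
  move=> x; rewrite -[x]vec_mxK.
  (* One constant for all coordinates: iterates of positive order are bounded by the norms of the
     twisted entries, and the second summand covers order 0. *)
  exists (\sum_i \sum_j (nrm (twist v u (vec_mx x) i j) + normc (vec_mx x i j))) => k r.
  rewrite orbE; case/mxvec_indexP: r => i j; rewrite mxvecE.
  have h1 : normc (iter k f (vec_mx x) i j) <=
      nrm (twist v u (vec_mx x) i j) + normc (vec_mx x i j).
    case: k => [|k]; first by rewrite lerDr nrm_ge0.
    have [phi phiS ->] := twist_val_iter k psiS vR uR.
    by rewrite (le_trans (twist_val_le _ _ _ _ _ phiS)) // lerDl normc_ge0.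
  apply: le_trans h1 _; rewrite (bigD1 i) //= (bigD1 j) //= -addrA lerDl.
  rewrite addr_ge0 // sumr_ge0 // => [j' _|i' _]; last apply: sumr_ge0 => j' _.
    by rewrite addr_ge0 ?nrm_ge0 ?normc_ge0.
  by rewrite addr_ge0 ?nrm_ge0 ?normc_ge0.
exists (vec_mx x) => [|i j d d0 hd].
  have : mxvec (f (vec_mx x)) = x by rewrite -(mul_vec_lin fL) vec_mxK.
  by move/(congr1 vec_mx); rewrite mxvecK.
have h : forall k,
    normc ((iter k (fun y => y *m M) (mxvec 1%:M) - mxvec 1%:M) 0 (mxvec_index i j)) <= d.
  move=> k; rewrite orbE -linearB /= mxvecE; case: k => [|k].
    by rewrite subrr mxE normc0.
  have [phi phiS ->] := twist_val_iter k psiS vR uR.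
  exact: hd.
have := hx _ _ h; rewrite -{1}(vec_mxK x) -linearB /= mxvecE //.
Qed.

(** Since u^* u = 1, the matrix v^* u - 1 equals (v - u)^* u. *)
Lemma twist_val_near phi v u i j : state phi -> unitary_rep u ->
  normc ((twist_val phi v u 1%:M - 1%:M) i j) <=
  \sum_k nrm (v k i - u k i) * nrm (u k j).
Proof.
move=> phiS [_ uu _].
have -> : twist_val phi v u 1%:M - 1%:M = map_mx phi (mxstar (v - u) *m u).
  by rewrite mxstarB mulmxBl uu map_stateB // map_state1 // /twist_val /twist scmx1 mulmx1.
rewrite mxE (le_trans (state_le phiS _)) // mxE (le_trans (nrm_sum _ _ _)) //.
by apply: ler_sum => k _; rewrite (le_trans (nrmM _ _)) // !mxE nrm_star.
Qed.

End Intertwiners.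

(** The eigenvalues are given as elements of [R], so that a largest one can be chosen. *)
Lemma hermitian_spectral (R : realType) n (S : 'M[R[i]]_n) : adjmx S = S ->
  exists (U : 'M[R[i]]_n) (d : 'rV[R]_n), [/\ U *m adjmx U = 1%:M, adjmx U *m U = 1%:M &
    S = adjmx U *m diag_mx (map_mx (real_complex R) d) *m U].
Proof.
move=> hS.
have Sherm : S \is hermsymmx.
  by apply/is_hermitianmxP; rewrite expr0 scale1r -[LHS]hS /adjmx map_trmx.
pose U := spectralmx S; pose d := spectral_diag S.
have UU : U *m adjmx U = 1%:M.
  by have /unitarymxP := spectral_unitarymx S; rewrite /adjmx map_trmx.
have UU' : adjmx U *m U = 1%:M by exact: mulmx1C.
exists U, (map_mx (@complex.Re R) d); split=> //.
have -> : map_mx (real_complex R) (map_mx (@complex.Re R) d) = d.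
  apply/matrixP => i j; rewrite !mxE; apply: RRe_real.
  by have /mxOverP := hermitian_spectral_diag_real Sherm; apply.
have /orthomx_spectralP := hermitian_normalmx Sherm.
by rewrite invmx_unitary ?spectral_unitarymx // /adjmx map_trmx.
Qed.

(** * Fixed points of the twisted slice map are intertwiners *)

Section Rigidity.
Variables (R : realType) (G : compactQuantumGroup R) (n : nat).
Variables (u v : 'M[G]_n) (psi : G -> R[i]) (g : seq G).
Hypotheses (uR : unitary_rep u) (uI : irreducible_rep u) (vR : unitary_rep v).
Hypotheses (psiS : state psi) (psiF : forall x, in_span g x -> psi (star x * x) = 0 -> x = 0).
Hypotheses (g1 : 1 \in g) (gu : forall i j, u i j \in g)
  (gvu : forall k i l j, star (v k i) * u l j \in g).

Lemma state_sum_sq0 (X : 'M[G]_n) j : (forall k, in_span g (X k j)) ->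
  \sum_k psi (star (X k j) * X k j) = 0 -> forall k, X k j = 0.
Proof.
move=> Xg /eqP; rewrite psumr_eq0 => [/allP h k|k _]; last exact: state_ge0.
by apply: psiF => //; apply/eqP/h; rewrite mem_index_enum.
Qed.

(* S is subharmonic for the positive unital map twist_val psi u u; by faithfulness
   its top eigenspace is invariant under u, hence everything. *)
Lemma subharmonic_scalar (S : 'M[R[i]]_n) (Y : 'M[G]_n) : adjmx S = S ->
  twist_val psi u u S - S = map_mx psi (mxstar Y *m Y) -> exists c, S = c%:M.
Proof.
move=> hS hY; have [U [d [UU UU' SE]]] := hermitian_spectral hS.
have [uu' uu _] := uR; have [n0 irr] := uI.
case: (arg_maxP (fun k => d 0 k) (erefl (predT (Ordinal n0)))) => m0 _ hm0.
set lam := d 0 m0 in hm0.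
pose D := diag_mx (map_mx (real_complex R) d).
pose W : 'M[G]_n := scmx G U *m u *m scmx G (adjmx U).
have sUU : scmx G U *m scmx G (adjmx U) = 1%:M by rewrite -scmxM UU scmx1.
have sUU' : scmx G (adjmx U) *m scmx G U = 1%:M by rewrite -scmxM UU' scmx1.
have Wstar : mxstar W = scmx G U *m mxstar u *m scmx G (adjmx U).
  by rewrite /W !mxstarM !mxstar_sc adjmxK mulmxA.
have WW : mxstar W *m W = 1%:M.
  rewrite Wstar /W !mulmxA -(mulmxA _ (scmx G (adjmx U)) (scmx G U)) sUU' mulmx1.
  by rewrite -(mulmxA _ (mxstar u) u) uu mulmx1.
have WDW : mxstar W *m scmx G D *m W =
    scmx G U *m twist u u S *m scmx G (adjmx U).
  by rewrite Wstar /W /twist SE !scmxM !mulmxA.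
have Wg i j : in_span g (W i j).
  rewrite scmx_mulr; apply: in_span_sum => k _; apply: in_spanZ.
  rewrite scmx_mull; apply: in_span_sum => l _; apply: in_spanZ.
  exact: in_span_mem.
have uE : u = scmx G (adjmx U) *m W *m scmx G U.
  by rewrite /W !mulmxA sUU' mul1mx -mulmxA sUU' mulmx1.
clearbody W.
(* [W] is [u] in an eigenbasis of [S]; since W^* W = 1, each column of [a] is a probability
   vector. *)
pose a k m := psi (star (W k m) * W k m).
have a0 k m : 0 <= a k m by exact: state_ge0.
have a1 m : \sum_k a k m = 1.
  by rewrite -map_state_sq // WW map_state1 // mxE eqxx.
have aD m : \sum_k (d 0 k)%:C * a k m = (U *m twist_val psi u u S *m adjmx U) m m.
  rewrite /twist_val -(map_state_mull psiS) -(map_state_mulr psiS) -WDW -mulmxA.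
  rewrite !mxE state_sum //; apply: eq_bigr => k _.
  rewrite scmx_mull (bigD1 k) //= big1 => [|l lk]; last first.
    by rewrite /D !mxE eq_sym (negPf lk) mulr0n scale0r.
  by rewrite addr0 /D !mxE eqxx mulr1n -scalerAr stateZ.
(* Conjugated by [U], the right-hand side of [hY] has sums of values of [psi] at elements x^* x on
   its diagonal; nonnegativity there is this inequality. *)
have aY m : (d 0 m)%:C <= \sum_k (d 0 k)%:C * a k m.
  have UY : U *m (twist_val psi u u S - S) *m adjmx U =
      map_mx psi (mxstar (Y *m scmx G (adjmx U)) *m (Y *m scmx G (adjmx U))).
    rewrite hY -(map_state_mull psiS) -(map_state_mulr psiS) mxstarM mxstar_sc adjmxK.
    by rewrite !mulmxA.
  have : 0 <= (U *m (twist_val psi u u S - S) *m adjmx U) m m.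
    by rewrite UY map_state_sq // sumr_ge0 // => k _; exact: state_ge0.
  have subE (B C : 'M[R[i]]_n) : (B - C) m m = B m m - C m m by rewrite !mxE.
  rewrite mulmxBr mulmxBl subE -aD subr_ge0.
  have -> : U *m S *m adjmx U = D.
    by rewrite SE !mulmxA UU mul1mx -mulmxA UU mulmx1.
  by rewrite !mxE eqxx mulr1n.
(* For [m] in the top eigenspace, the average of the eigenvalues with weights [a k m] reaches the
   maximum [lam], so no weight lies outside that eigenspace; faithfulness turns zero weights into
   zero entries. *)
have W0 k m : d 0 m = lam -> d 0 k != lam -> W k m = 0.
  move=> dm dk; have t0 l : 0 <= (lam - d 0 l)%:C * a l m.
    by rewrite mulr_ge0 // ler0c subr_ge0; exact: hm0.
  have : \sum_l (lam - d 0 l)%:C * a l m = 0.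
    apply/eqP; rewrite eq_le sumr_ge0 // andbT.
    have -> : \sum_l (lam - d 0 l)%:C * a l m = lam%:C * \sum_l a l m - \sum_l (d 0 l)%:C * a l m.
      by rewrite mulr_sumr -sumrB; apply: eq_bigr => l _; rewrite rmorphB mulrBl.
    by rewrite a1 mulr1 subr_le0 -dm aY.
  move/eqP; rewrite psumr_eq0 // => /allP/(_ k (mem_index_enum _))/=.
  rewrite mulf_eq0 => /orP[|/eqP ak]; last exact: psiF.
  rewrite -(rmorph0 (real_complex R)) (inj_eq (@complexI R)) subr_eq0 eq_sym.
  by rewrite (negPf dk).
(* The projection onto the top eigenspace, as [E] in the eigenbasis and as [p] in the original
   one. *)
pose E : 'M[R[i]]_n := diag_mx (\row_k (d 0 k == lam)%:R).
pose p := adjmx U *m E *m U.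
have EE : E *m E = E.
  rewrite mulmx_diag; congr diag_mx; apply/rowP => k; rewrite !mxE.
  by case: (_ == _); rewrite ?mulr1 ?mulr0.
have Es : adjmx E = E.
  apply/matrixP => i j; rewrite !mxE [j == i]eq_sym; case: (eqVneq i j) => [->|_].
    by rewrite !mulr1n conjC_nat.
  by rewrite !mulr0n conjC0.
have pp : p *m p = p.
  by rewrite /p !mulmxA -(mulmxA _ U) UU mulmx1 -(mulmxA _ E E) EE.
have ps : adjmx p = p by rewrite /p !adjmxM Es adjmxK mulmxA.
have EWE : scmx G E *m W *m scmx G E = W *m scmx G E.
  apply/matrixP => k m; rewrite !scmx_mulr; apply: eq_bigr => l _.
  rewrite scmx_mull (bigD1 k) //= big1 => [|j jk]; last first.
    by rewrite !mxE [k == j]eq_sym (negPf jk) mulr0n scale0r.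
  rewrite addr0 !mxE eqxx mulr1n; case: (eqVneq l m) => [->|lm]; last by rewrite mulr0n !scale0r.
  rewrite !mulr1n; have [dm|_] := eqVneq (d 0 m) lam; last by rewrite !scale0r.
  by have [_|dk] := eqVneq (d 0 k) lam; rewrite ?scale1r // W0 // scaler0.
have quq : scmx G p *m u *m scmx G p = u *m scmx G p.
  have -> : scmx G p *m u *m scmx G p = scmx G (adjmx U) *m (scmx G E *m W *m scmx G E) *m scmx G U.
    rewrite {1}uE /p !scmxM !mulmxA -(mulmxA _ (scmx G U) (scmx G (adjmx U))) sUU mulmx1.
    by rewrite -(mulmxA _ (scmx G U) (scmx G (adjmx U))) sUU mulmx1.
  rewrite EWE uE /p !scmxM !mulmxA.
  by rewrite -(mulmxA _ (scmx G U) (scmx G (adjmx U))) sUU mulmx1.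
have UpU : U *m p *m adjmx U = E.
  by rewrite /p !mulmxA UU mul1mx -mulmxA UU mulmx1.
(* The projection is nonzero because of [m0], where the maximum is attained; being 1, it forces all
   eigenvalues to equal [lam]. *)
case: (irr p pp ps quq) => [p0|p1].
  have := congr1 (fun M : 'M[R[i]]_n => M m0 m0) UpU.
  by rewrite p0 mulmx0 mul0mx !mxE !eqxx mulr1n => /eqP; rewrite eq_sym oner_eq0.
have dl k : d 0 k = lam.
  have := congr1 (fun M : 'M[R[i]]_n => M k k) UpU.
  rewrite p1 mulmx1 UU !mxE !eqxx mulr1n; case: eqVneq => // _ /eqP.
  by rewrite oner_eq0.
exists lam%:C; rewrite SE.
have -> : diag_mx (map_mx (real_complex R) d) = (lam%:C)%:M.
  by apply/matrixP => i j; rewrite !mxE dl.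
by rewrite mul_mx_scalar -scalemxAl UU' scalemx1.
Qed.

Lemma twist_fixed T : twist_val psi v u T = T -> twist v u T = scmx G T.
Proof.
move=> fT; have [uu' uu _] := uR; have [vv' vv _] := vR.
pose X := twist v u T; pose Y := X - scmx G T; pose S := adjmx T *m T.
have XX : mxstar X *m X = twist u u S.
  rewrite /X /twist !mxstarM mxstarK mxstar_sc scmxM !mulmxA.
  by rewrite -(mulmxA _ v) vv' mulmx1.
(* The cross terms slice to T^* T because the slice of [X] is T. *)
have YY : map_mx psi (mxstar Y *m Y) = twist_val psi u u S - S.
  rewrite /Y mxstarB mulmxBl !mulmxBr XX mxstar_sc -scmxM -/S.
  rewrite !map_stateB // map_state_sc // map_state_mull // map_state_mulr //.
  rewrite map_state_star // -/(twist_val psi v u T) fT -/S -/(twist_val psi u u S).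
  by rewrite subrr subr0.
have hS : adjmx S = S by rewrite adjmxM adjmxK.
have [c Sc] := subharmonic_scalar hS (esym YY).
(* A scalar [S] commutes with u^*, so u^* S u = S and the two terms cancel. *)
have YY0 : map_mx psi (mxstar Y *m Y) = 0.
  rewrite YY /twist_val /twist Sc.
  have -> : mxstar u *m scmx G c%:M = scmx G c%:M *m mxstar u.
    have cE i j : c%:M i j = c *+ (i == j) by rewrite mxE.
    apply/matrixP => i j; rewrite scmx_mull scmx_mulr; transitivity (c *: mxstar u i j).
      rewrite (bigD1 j) //= big1 => [|k kj]; first by rewrite cE eqxx addr0.
      by rewrite cE (negPf kj) scale0r.
    rewrite (bigD1 i) //= big1 => [|k ki]; first by rewrite cE eqxx addr0.
    by rewrite cE eq_sym (negPf ki) scale0r.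
  by rewrite -mulmxA uu mulmx1 map_state_sc // subrr.
have Yg i j : in_span g (Y i j).
  have -> : Y i j = twist v u T i j - T i j *: 1.
    have subE (B C : 'M[G]_n) : (B - C) i j = B i j - C i j by rewrite !mxE.
    by rewrite /Y subE; congr (_ - _); rewrite mxE.
  apply: in_spanB.
    rewrite twistE; apply: in_span_sum => l _; apply: in_span_sum => k _.
    by apply/in_spanZ/in_span_mem.
  by apply/in_spanZ/in_span_mem.
have Y0 : Y = 0.
  apply/matrixP => k j; rewrite [RHS]mxE; apply: state_sum_sq0 => //.
  by rewrite -map_state_sq // YY0 mxE.
exact: subr0_eq.
Qed.

End Rigidity.

(** * The invariant Lip-norm *)

Section CoefSpan.
Variables (R : realType) (G : compactQuantumGroup R) (n : nat) (u v : 'M[G]_n).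
Hypotheses (uR : unitary_rep u) (uI : irreducible_rep u) (vR : unitary_rep v).

(** Slices by states move 1 by at most d C in each entry, so the fixed point T is within d C of 1,
    hence invertible, and it intertwines. Consequently the coefficients of [u] are linear
    combinations of those of [v]. *)
Lemma near_rep_equiv (d : R) : 0 <= d -> n%:R * (d * \sum_i \sum_j nrm (u i j)) < 1 ->
  (forall i j, nrm (v i j - u i j) <= d) ->
  exists2 T : 'M[R[i]]_n, T \in unitmx & u = scmx G (invmx T) *m v *m scmx G T.
Proof.
move=> d0 nd hd; set C := \sum_i _ in nd.
have [H [_ [pi [_ [piR piI _ _ _]]]]] := tens_norm (tens_spatial G).
(* The span of [g] contains all elements to which faithfulness is applied: the entries of [u] in an
   eigenbasis, and those of v^* T u - T. *)
pose g : seq G := 1 :: codom (fun p : 'I_n * 'I_n => u p.1 p.2) ++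
  codom (fun p : ('I_n * 'I_n) * ('I_n * 'I_n) => star (v p.1.1 p.1.2) * u p.2.1 p.2.2).
have g1 : 1 \in g by rewrite mem_head.
have gu i j : u i j \in g.
  rewrite inE mem_cat (codom_f (fun p : 'I_n * 'I_n => u p.1 p.2) (i, j)) orbT //.
have gvu k i l j : star (v k i) * u l j \in g.
  rewrite inE mem_cat (codom_f (fun p : ('I_n * 'I_n) * ('I_n * 'I_n) =>
    star (v p.1.1 p.1.2) * u p.2.1 p.2.2) ((k, i), (l, j))) !orbT //.
have [psi psiS psiF] := faithful_state piR piI g.
have [T fT hT] := twist_val_fixed psiS vR uR.
have C0 : 0 <= C by apply: sumr_ge0 => i _; apply: sumr_ge0 => j _; exact: nrm_ge0.
have Tu : T \in unitmx.
  apply: (unitmx_near1 nd) => i j; apply: hT => [|phi phiS]; first exact: mulr_ge0.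
  apply: le_trans (twist_val_near _ _ _ phiS uR) _.
  rewrite /C mulr_sumr; apply: ler_sum => k _.
  apply: ler_pM; rewrite ?nrm_ge0 //.
  by rewrite (bigD1 j) //= lerDl sumr_ge0 // => l _; exact: nrm_ge0.
exists T => //; have [vv' _ _] := vR.
have E := twist_fixed uR uI vR psiS psiF g1 gu gvu fT.
have : v *m twist v u T = scmx G T *m u by rewrite /twist !mulmxA vv' mul1mx.
rewrite E => {}E; rewrite -mulmxA E mulmxA -scmxM mulVmx // scmx1 mul1mx //.
Qed.

End CoefSpan.

(** * Countably many elements whose span contains all regular functions *)

Section Separable.
Variables (R : realType) (G : compactQuantumGroup R) (s : nat -> G).
Hypothesis sdense : forall x (e : R), 0 < e -> exists k, nrm (x - s k) < e.

(* The value is 0 when no unitary representation is that close to the matrix of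
   the s (q i j). *)
Definition near_rep n (q : 'M[nat]_n) (m : nat) : 'M[G]_n :=
  xget 0 [set v | unitary_rep v /\ forall i j, nrm (v i j - s (q i j)) < m.+1%:R^-1].

(** One representation is chosen for each index matrix [q] and precision [m], so the dense sequence
    and all chosen coefficients can be enumerated together. *)
Definition generators (k : nat) : G :=
  match @unpickle (nat + {n : nat & 'M[nat]_n * nat * 'I_n * 'I_n})%type k with
  | Some (inl j) => s j
  | Some (inr (existT n (q, m, i, j))) => @near_rep n q m i j
  | None => 0
  end.

Lemma generators_dense x (e : R) : 0 < e -> exists k, nrm (x - generators k) < e.
Proof.
move=> /(sdense x)[j hj].
exists (pickle (inl j : nat + {n : nat & 'M[nat]_n * nat * 'I_n * 'I_n})).
by rewrite /generators pickleK.
Qed.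

Lemma near_rep_generator n (q : 'M[nat]_n) m i j : exists k, near_rep q m i j = generators k.
Proof.
pose x : {n : nat & 'M[nat]_n * nat * 'I_n * 'I_n}%type := existT _ n (q, m, i, j).
by exists (pickle (inr x : nat + _)); rewrite /generators pickleK.
Qed.

(** If the entries of [u] are approximated along [q], then [u] itself is a candidate for
    [near_rep q m], so the choice succeeds; two errors below 1/(m + 1), each at most d/2, add up. *)
Lemma near_rep_exists n (u : 'M[G]_n) (d : R) : unitary_rep u -> 0 < d ->
  exists (q : 'M[nat]_n) m, unitary_rep (near_rep q m) /\
    forall i j, nrm (near_rep q m i j - u i j) <= d.
Proof.
move=> uR d0; pose m := Num.truncn (2 / d).
have m0 : 0 < m.+1%:R^-1 :> R by rewrite invr_gt0.
have md : 2 * m.+1%:R^-1 <= d.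
  by rewrite ler_pdivrMr // mulrC -ler_pdivrMr // ltW // truncnS_gt.
have /choice[f hf] (p : 'I_n * 'I_n) : exists k, nrm (u p.1 p.2 - s k) < m.+1%:R^-1.
  exact: sdense.
pose q : 'M[nat]_n := \matrix_(i, j) f (i, j).
have [vR hv] : unitary_rep (near_rep q m) /\
    forall i j, nrm (near_rep q m i j - s (q i j)) < m.+1%:R^-1.
  rewrite /near_rep; case: xgetP => [v _ //|/(_ u) no]; exfalso; apply: no.
  by split=> // i j; rewrite mxE; exact: (hf (i, j)).
exists q, m; split=> // i j; apply: le_trans (nrm_tri (s (q i j)) _ _) _.
have qE : q i j = f (i, j) by rewrite mxE.
have h2 := hf (i, j); rewrite /= nrmBC -qE in h2; apply: le_trans (ltW (ltrD (hv i j) h2)) _.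
by rewrite -mulr2n -[leLHS]mulr_natl; apply: md.
Qed.

Lemma orbit_gauge_regular : regular (orbit_gauge generators).
Proof.
move=> _ [N [c [x [hx ->]]]]; apply: gauge_fin_sum => r _; apply: gauge_finZ.
have [n [u [uR uI [i [j ->]]]]] := hx r.
(* This [d] gives n d C < 1, as [near_rep_equiv] requires. *)
pose C := \sum_i \sum_j nrm (u i j); pose d := (n%:R * C + 1)^-1.
have C0 : 0 <= C by apply: sumr_ge0 => k _; apply: sumr_ge0 => l _; exact: nrm_ge0.
have D0 : 0 < n%:R * C + 1 by rewrite ltr_wpDl // mulr_ge0.
have d0 : 0 < d by rewrite invr_gt0.
have nd : n%:R * (d * C) < 1.
  by rewrite mulrCA /d mulrC ltr_pdivrMr // mul1r ltrDl.
have [q [m [vR hv]]] := near_rep_exists uR d0.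
(* The coefficient of [u] becomes a finite combination of coefficients of the chosen representation,
   each of which is a generator. *)
have [T _ ->] := near_rep_equiv uR uI vR (ltW d0) nd hv.
rewrite scmx_mulr; apply: gauge_fin_sum => l _; apply: gauge_finZ.
rewrite scmx_mull; apply: gauge_fin_sum => k _; apply: gauge_finZ.
by have [p ->] := near_rep_generator q m k l; exact: orbit_gauge_fin.
Qed.

End Separable.

Lemma separable_seq (R : realType) (V : normedModType R[i]) : separable V ->
  exists s : nat -> V, forall x (e : R), 0 < e -> exists k, nrm (x - s k) < e.
Proof.
move=> [S [/countable_injP[f fI] dS]].
(* The sequence inverts the injection [f] of [S] into the natural numbers, with value 0 off its
   range. *)
exists (fun k => xget 0 [set y | S y /\ f y = k]) => x e e0.
have [y Sy xy] := dense_nrm dS x e0; exists (f y).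
case: xgetP => [z _ [Sz fz]|/(_ y) no]; last by exfalso; apply: no.
by rewrite (fI z y) // inE.
Qed.

Theorem corollary8p10 (R : realType) (G : compactQuantumGroup R) :
  separable G -> bounded_counit G ->
  exists L : G -> \bar R,
    [/\ lip_norm L, regular L, left_invariant L & right_invariant L].
Proof.
move=> /separable_seq[s sdense] _; exists (orbit_gauge (generators s)); split.
- by apply: orbit_gauge_lip_norm => b e; exact: generators_dense.
- exact: orbit_gauge_regular.
- exact: orbit_gauge_left_invariant.
- exact: orbit_gauge_right_invariant.
Qed.
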